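(* Assume that a symmetric space $X$ on $[0,1]$ has the Kruglov property and that for some $q\in(2,\infty]$ the space $\ell_q$ ($c_0$ if $q=\infty$) is roughly lattice finitely representable in $X$. Then $X$ does not have the property (IR).
   Context: All functions are real-valued Lebesgue measurable functions on $[0,1]$ with Lebesgue measure $m$ (modulo a.e. equality); independence is with respect to $m$. Symmetric space (s.s.) on $[0,1]$: a Banach space $X$ of measurable functions on $[0,1]$ such that (1) if $x\in X$ and $y$ is measurable with $|y|\le|x|$ a.e., then $y\in X$ and $\|y\|_X\le\|x\|_X$; (2) if $x\in X$ and $|x|,|y|$ are identically distributed, then $y\in X$ and $\|y\|_X=\|x\|_X$. It is assumed throughout that $\|\chi_{[0,1]}\|_X=1$. Kruglov property: for a measurable $f$ on $[0,1]$ let $\pi(f)$ be the random variable $\sum_{k=1}^{\mathcal N}f_k$, where $f_1,f_2,\dots$ are independent copies of $f$ and $\mathcal N$ is a Poisson random variable with parameter $1$ independent of $\{f_k\}$. $X$ has the Kruglov property if $f\in X$ implies $\pi(f)\in X$ (i.e. a function on $[0,1]$ with the same distribution as $\pi(f)$ belongs to $X$). Rough lattice finite representability: for $1\le q\le\infty$, $\ell_q$ ($c_0$ if $q=\infty$) is roughly lattice finitely representable in $X$ if there is a constant $K>0$ such that for every $N\in\mathbb N$ there exist pairwise disjoint (disjointly supported) functions $x_1,\dots,x_N\in X$ with $$K^{-1}\|(a_k)\|_{\ell_q^N}\le\Big\|\sum_{k=1}^N a_kx_k\Big\|_X\le K\|(a_k)\|_{\ell_q^N}\quad\text{for all }a_1,\dots,a_N\in\mathbb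 R.$$ Kolmogorov width: for $K\subset X$, $d_n(K,X):=\inf_{\dim V\le n}\sup_{x\in K}\inf_{v\in V}\|x-v\|_X$, the infimum over linear subspaces $V\subset X$ of dimension at most $n$; for non-integer $r$, $d_r:=d_{\lfloor r\rfloor}$. Property (IR): $X$ has the property (IR) if there exists $\gamma>0$ such that for any $N\in\mathbb N$ and arbitrary independent functions $f_1,\ldots,f_N\in X$ with $\int_0^1f_k(x)\,dx=0$ and $\|f_k\|_X\ge1$, $k=1,\ldots,N$, we have $d_{\gamma N}(\{f_1,\ldots,f_N\},X)\ge\gamma$. *)

(* Defs.v *)
From HB Require Import structures.
From mathcomp Require Import all_boot all_order all_algebra.
From mathcomp Require Import all_classical all_reals all_analysis.

Set Implicit Arguments.
Unset Strict Implicit.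
Unset Printing Implicit Defensive.

Import Order.TTheory GRing.Theory Num.Theory.
Import numFieldNormedType.Exports.

Local Open Scope classical_set_scope.
Local Open Scope ring_scope.

(* The real line with the Lebesgue (not merely Borel) sigma-algebra. *)
Definition lebesgueTypeR (R : realType) : measurableType _ :=
  caratheodory_type ((@wlength R idfun)^*)%mu.

Definition unit_itv (R : realType) : set (lebesgueTypeR R) :=
  [set x : R | 0 <= x <= 1].

Lemma measurable_unit_itv (R : realType) : measurable (@unit_itv R).
Proof.
have -> : @unit_itv R = `[0%R : R, 1%R]%classic.
  by apply/seteqP; split => x /=; rewrite in_itv.
by apply: sub_caratheodory; exact: measurable_itv.
Qed.

(* Lebesgue measure on [0, 1], carried by the whole line: a function on [0, 1]
   modulo a.e. equality is a function on the line modulo [leb01]-a.e. equality,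
   its values outside [0, 1] being irrelevant. *)
Definition leb01 (R : realType) : set (lebesgueTypeR R) -> \bar R :=
  mrestr (@completed_lebesgue_measure R) (@measurable_unit_itv R).

HB.instance Definition _ (R : realType) := Measure.on (@leb01 R).

Lemma leb01_setT (R : realType) : @leb01 R setT = 1%E.
Proof.
rewrite /leb01 /mrestr setTI.
have -> : @unit_itv R = `[0%R : R, 1%R]%classic.
  by apply/seteqP; split => x /=; rewrite in_itv.
have -> : @completed_lebesgue_measure R `[0%R : R, 1%R]%classic
        = @lebesgue_measure R `[0%R : R, 1%R]%classic by [].
by rewrite lebesgue_measure_itv /= lte_fin ltr01 oppr0 adde0.
Qed.

HB.instance Definition _ (R : realType) :=
  Measure_isProbability.Build _ _ _ (@leb01 R) (@leb01_setT R).

Section probability_notions.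
Context (R : realType).

Definition same_law d1 (T1 : measurableType d1) (P1 : probability T1 R)
    d2 (T2 : measurableType d2) (P2 : probability T2 R)
    (f : T1 -> R) (g : T2 -> R) : Prop :=
  forall A : set R, measurable A -> P1 (f @^-1` A) = P2 (g @^-1` A).

Definition events_of d (T : measurableType d) d' (T' : measurableType d')
    (f : T -> T') : set (set T) :=
  [set f @^-1` A | A in measurable].

Definition independent_classes d (T : measurableType d) (P : probability T R)
    (I : eqType) (C : I -> set (set T)) : Prop :=
  forall (J : seq I) (E : I -> set T),
    uniq J -> (forall i, i \in J -> C i (E i)) ->
    P (\bigcap_(i in [set` J]) E i) = (\prod_(i <- J) P (E i))%E.

Definition independent_functions d (T : measurableType d)
    (P : probability T R) (I : eqType) (f : I -> T -> R) : Prop :=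
  independent_classes P (fun i => events_of (f i)).

(* [F] is a sequence of copies of the function [f] on [0, 1] and [N] is Poisson
   with parameter 1; [None] indexes [N] in the independent family
   N, F 0, F 1, ... *)
Definition kruglov_data (f : lebesgueTypeR R -> R)
    d (T : measurableType d) (P : probability T R)
    (F : nat -> {RV P >-> R}) (N : {RV P >-> nat}) : Prop :=
  [/\ forall k, same_law P (@leb01 R) (F k) f,
      forall n, P (N @^-1` [set n]) = (poisson_pmf 1 n)%:E
    & independent_classes P (fun o : option nat =>
        if o is Some k then events_of (F k) else events_of N)].

End probability_notions.

(* The function space is an abstract Banach space together with a linear
   embedding [ss_fun] into the measurable functions modulo a.e. equality;
   [ss_fun x] is some representative of the class of [x], so "y belongs to X"
   reads "y agrees a.e. with [ss_fun z] for some z". *)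
Record symmetric_space (R : realType) := SymmetricSpace {
  ss_space :> completeNormedModType R;
  ss_fun : ss_space -> {mfun lebesgueTypeR R >-> R};
  ss_fun_linear : forall (a : R) (x y : ss_space),
    (ss_fun (a *: x + y) : _ -> R) =
      (fun t => a * ss_fun x t + ss_fun y t) %[ae @leb01 R];
  ss_fun_inj : forall x : ss_space,
    (ss_fun x : _ -> R) = cst 0 %[ae @leb01 R] -> x = 0;
  ss_ideal : forall (x : ss_space) (y : {mfun lebesgueTypeR R >-> R}),
    {ae @leb01 R, forall t, `|y t| <= `|ss_fun x t|} ->
    exists2 z : ss_space,
      (ss_fun z : _ -> R) = y %[ae @leb01 R] & `|z| <= `|x|;
  ss_symmetric : forall (x : ss_space) (y : {mfun lebesgueTypeR R >-> R}),
    same_law (@leb01 R) (@leb01 R)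
      (fun t => `|ss_fun x t|) (fun t => `|y t|) ->
    exists2 z : ss_space,
      (ss_fun z : _ -> R) = y %[ae @leb01 R] & `|z| = `|x|;
  ss_unit : exists2 e : ss_space,
    (ss_fun e : _ -> R) = cst 1 %[ae @leb01 R] & `|e| = 1
}.

Definition kruglov_property (R : realType) (X : symmetric_space R) : Prop :=
  forall (x : X) d (T : measurableType d) (P : probability T R)
    (F : nat -> {RV P >-> R}) (N : {RV P >-> nat}),
    kruglov_data (ss_fun x) F N ->
    exists y : X, same_law (@leb01 R) P
      (ss_fun y) (fun w => \sum_(k < N w) F k w).

(* The l_q^N norm, for q > 0 (junk value 0 at q = -oo). *)
Definition lq_norm (R : realType) (q : \bar R) (N : nat) (a : 'I_N -> R) : R :=
  match q with
  | r%:E%E => (\sum_k `|a k| `^ r) `^ r^-1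
  | +oo%E => \big[Num.max/0]_k `|a k|
  | -oo%E => 0
  end.

Definition roughly_lattice_finitely_representable (R : realType)
    (q : \bar R) (X : symmetric_space R) : Prop :=
  exists2 K : R, 0 < K & forall N : nat, (0 < N)%N ->
    exists x : 'I_N -> X,
      (forall i j, i != j ->
        {ae @leb01 R, forall t, ss_fun (x i) t = 0 \/ ss_fun (x j) t = 0}) /\
      (forall a : 'I_N -> R,
        K^-1 * lq_norm q a <= `|\sum_k a k *: x k| <= K * lq_norm q a).

Section kolmogorov_width.
Context (R : realType) (X : normedModType R).

Definition subspace_of_dim (V : set X) (m : nat) : Prop :=
  exists b : 'I_m -> X,
    (forall c : 'I_m -> R, \sum_i c i *: b i = 0 -> forall i, c i = 0) /\
    V = [set \sum_i c i *: b i | c in [set: 'I_m -> R]].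

(* Meant for nonempty [K]: the supremum over the empty set is -oo. *)
Definition kolmogorov_width (n : nat) (K : set X) : \bar R :=
  ereal_inf [set
    ereal_sup [set ereal_inf [set `|x - v|%:E | v in V] | x in K]
    | V in [set V | exists2 m, (m <= n)%N & subspace_of_dim V m]].

End kolmogorov_width.

Definition property_IR (R : realType) (X : symmetric_space R) : Prop :=
  exists2 g : R, 0 < g & forall N : nat, (0 < N)%N -> forall f : 'I_N -> X,
    independent_functions (@leb01 R) (fun k => ss_fun (f k)) ->
    (forall k, (\int[@leb01 R]_t (ss_fun (f k) t)%:E = 0)%E) ->
    (forall k, 1 <= `|f k|) ->
    (g%:E <= kolmogorov_width (Num.truncn (g * N%:R)) (range f))%E.

(* Main.v *)
(* Realize a Poisson process on [0, 1] by a count [N] and independent uniform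
   points [Y j], both functions on [0, 1]. By the Kruglov property and a gliding
   hump, [g |-> \sum_(j < N) g (Y j)] is bounded on the nonnegative cone of [X].
   If the functions [g k] are disjoint copies of the basis of l_q, the maxima
   [M k = \max_(j < N) g k (Y j)] are independent, because a Poisson process is
   independent on disjoint sets; and [M k <= \sum_(j < N) g k (Y j)], so the
   centred maxima [f k] satisfy an upper l_q-estimate while their norms stay
   bounded below.

   Index the [f k] by the [L p^2] polynomials [l x^2 + b x + c] over F_p with
   [l < L]. Two of them agree in at most two points, hence replacing [f k] by the
   average over [x] in F_p of the sums of all [f j] with [j x = k x] costs at most
   the l_q norm of [L p^2] coefficients bounded by [2 / p]. This tends to 0 since
   [q > 2], whereas the averages span at most [p^2] dimensions, a fraction [1 / L]
   of the number of functions. *)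
From HB Require Import structures.
From mathcomp Require Import all_boot all_order all_algebra.
From mathcomp Require Import all_classical all_reals all_analysis.
From mathcomp Require Import measurable_realfun ring lra zify.
Require Import Defs.

Set Implicit Arguments.
Unset Strict Implicit.
Unset Printing Implicit Defensive.

Import Order.TTheory GRing.Theory Num.Theory.
Import numFieldNormedType.Exports.

Local Open Scope classical_set_scope.
Local Open Scope ring_scope.

(** * Independence from rays *)

(** Maxima replace the Poisson sums for the sake of independence: for [s > 0], a maximum lies below
    [s] when no point falls in the set where [s <= g]. This event has probability exp of minus the
    measure of that set, so disjoint unions turn into products. Independence of the sums would call
    for the joint law of the point counts.

    Centring is imposed by (IR) and might destroy the lower bound of the norms. It does not: on
    [N = 0] the maximum is 0, so the centred maximum is minus its mean there, and a small centred
    norm forces a small mean.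

    The Kruglov property gives membership in [X] only; a uniform constant has to be extracted from
    completeness. The points are realised on [0, 1] itself, by maps measurable from Lebesgue sets to
    Lebesgue sets, because they get composed with functions of [X], which are merely Lebesgue
    measurable. *)

Lemma ray_unique d1 d2 (T1 : measurableType d1) (T2 : measurableType d2)
    (R : realType) (m1 : {finite_measure set T1 -> \bar R})
    (m2 : {finite_measure set T2 -> \bar R}) (f1 : T1 -> R) (f2 : T2 -> R) :
  measurable_fun setT f1 -> measurable_fun setT f2 ->
  (forall t, m1 (f1 @^-1` `]t, +oo[) = m2 (f2 @^-1` `]t, +oo[)) ->
  forall A : set R, measurable A -> m1 (f1 @^-1` A) = m2 (f2 @^-1` A).
Proof.
move=> mf1 mf2 m12 A mA.
pose F1 : {mfun T1 >-> R} := HB.pack f1 (isMeasurableFun.Build _ _ _ _ _ mf1).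
pose F2 : {mfun T2 >-> R} := HB.pack f2 (isMeasurableFun.Build _ _ _ _ _ mf2).
rewrite -[LHS]/(pushforward m1 F1 A) -[RHS]/(pushforward m2 F2 A).
(* Open right rays are stable under intersection, generate the Borel sets and exhaust the line. *)
apply: (@measure_unique _ _ _ (@RGenOInfty.G R)
    (fun k : nat => `](- k%:R), +oo[%classic)) => //.
- exact: RGenOInfty.measurableE.
- move=> _ _ [s ->] [t ->]; exists (Num.max s t).
  apply/seteqP; split => x /=; rewrite !in_itv /= !andbT gt_max.
    by case=> -> ->.
  by move/andP.
- by move=> k; exists (- k%:R).
- rewrite -subTset => x _.
  exists (Num.truncn `|x|).+1 => //=.
  rewrite in_itv /= andbT ltrNl (le_lt_trans (ler_norm _)) // normrN.
  by have := truncnS_gt `|x|.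
- by move=> _ [t ->]; exact: m12.
- move=> k; rewrite -ge0_fin_numE //; apply: fin_num_measure.
  exact: (measurable_funPTI F1).
Qed.

Lemma bigcap_seq_cons T (I : eqType) (i : I) (J : seq I) (E : I -> set T) :
  \bigcap_(k in [set` i :: J]) E k = E i `&` \bigcap_(k in [set` J]) E k.
Proof.
apply/seteqP; split => x.
  move=> h; split; first by apply: h; rewrite /= mem_head.
  by move=> k kJ; apply: h; rewrite /= inE kJ orbT.
by case=> xi xJ k /=; rewrite inE => /orP[/eqP -> //|]; exact: xJ.
Qed.

Lemma bigcap_seq_measurable d (T : measurableType d) (I : eqType) (J : seq I)
    (E : I -> set T) : (forall i, i \in J -> measurable (E i)) ->
  measurable (\bigcap_(i in [set` J]) E i).
Proof.
elim: J => [|i J IH] mE.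
  by rewrite set_nil bigcap_set0.
rewrite bigcap_seq_cons; apply: measurableI; first by apply: mE; rewrite mem_head.
by apply: IH => k kJ; apply: mE; rewrite inE kJ orbT.
Qed.

Section independence_of_rays.
Context d (T : measurableType d) (R : realType) (P : probability T R).
Context (I : eqType) (f : I -> T -> R).
Hypothesis mf : forall i, measurable_fun setT (f i).
Hypothesis rays : forall (J : seq I) (t : I -> R), uniq J ->
  P (\bigcap_(i in [set` J]) f i @^-1` `]t i, +oo[) =
    (\prod_(i <- J) P (f i @^-1` `]t i, +oo[))%E.

Let preim_measurable i (B : set R) : measurable B -> measurable (f i @^-1` B).
Proof. by move=> mB; rewrite -[X in measurable X]setTI; exact: mf. Qed.

(* The rays indexed by [J] are replaced by Borel sets one index at a time. *)
Lemma rays_independent : independent_functions P f.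
Proof.
suff H (J1 J2 : seq I) (B : I -> set R) : uniq (J1 ++ J2) ->
    (forall i, i \in J1 -> measurable (B i)) ->
    (forall i, i \in J2 -> exists t, B i = `]t, +oo[%classic) ->
    P (\bigcap_(i in [set` J1 ++ J2]) f i @^-1` B i) =
      (\prod_(i <- J1 ++ J2) P (f i @^-1` B i))%E.
  move=> J E uJ hE.
  have hB i : exists B : set R, i \in J -> measurable B /\ f i @^-1` B = E i.
    case: (boolP (i \in J)) => [/hE[B mB BE]|_]; first by exists B.
    by exists set0.
  have [B hB'] := choice hB.
  have := H J [::] B; rewrite cats0 => /(_ uJ (fun i iJ => (hB' i iJ).1)).
  move=> /(_ (fun i => ltac:(done))) H'.
  transitivity (P (\bigcap_(i in [set` J]) f i @^-1` B i)).
    by congr (P _); apply: eq_bigcapr => i /= /hB'[].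
  by rewrite H'; apply: eq_big_seq => i /hB'[_ ->].
elim: J1 J2 B => [|i J1 IH] J2 B.
  rewrite /= => uJ _ hJ.
  have ht i : exists t, i \in J2 -> B i = `]t, +oo[%classic.
    by case: (boolP (i \in J2)) => [/hJ[t ->]|_]; [exists t|exists 0].
  have [t ht'] := choice ht.
  transitivity (P (\bigcap_(i in [set` J2]) f i @^-1` `]t i, +oo[)).
    by congr (P _); apply: eq_bigcapr => i /= /ht' ->.
  by rewrite rays //; apply: eq_big_seq => i /ht' ->.
rewrite cat_cons cons_uniq => /andP[iJ uJ] mB hJ.
rewrite bigcap_seq_cons big_cons.
set C := \bigcap_(_ in _) _; set p := (\prod_(_ <- _) _)%E.
have mJ k : k \in J1 ++ J2 -> measurable (B k).
  rewrite mem_cat => /orP[kJ|/hJ[t ->] //].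
  by apply: mB; rewrite inE kJ orbT.
have mC : measurable C.
  by apply: bigcap_seq_measurable => k /mJ; exact: preim_measurable.
have PC : P C = p.
  apply: IH => // k kJ; first by apply: mB; rewrite inE kJ orbT.
pose r : {nonneg R} := NngNum (fine_ge0 (measure_ge0 P C)).
have rE : r%:num%:E = p by rewrite -PC /= fineK // fin_num_measure.
have mBi : measurable (B i) by apply: mB; rewrite mem_head.
(* As functions of the set at index [i], both sides are finite measures: [P] restricted to [C], and
   [P] multiplied by the mass of [C]. Comparing them on rays suffices. *)
suff hr t : P (f i @^-1` `]t, +oo[ `&` C) = (P (f i @^-1` `]t, +oo[) * p)%E.
  rewrite -rE muleC.
  apply: (@ray_unique _ _ _ _ _ (mrestr P mC) (mscale r P)) => // t.
  by rewrite /= /mrestr /mscale rE hr muleC.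
(* Once it carries a ray, [i] moves from the Borel indices to the ray indices and the induction
   hypothesis applies with [i :: J2]. *)
pose B' k := if k == i then `]t, +oo[%classic else B k.
have B'E k : k \in J1 ++ J2 -> B' k = B k.
  by move=> kJ; rewrite /B'; case: eqP => // ki; rewrite -ki kJ in iJ.
have B'i : B' i = `]t, +oo[%classic by rewrite /B' eqxx.
have pm : perm_eq (J1 ++ i :: J2) (i :: J1 ++ J2).
  by apply/seq.permP => a; rewrite /= !count_cat /= addnCA.
have := IH (i :: J2) B'.
rewrite (perm_uniq pm) cons_uniq iJ uJ.
rewrite [X in bigcap X _](_ : _ = [set` i :: J1 ++ J2]); last first.
  by apply/seteqP; split => k /=; rewrite (perm_mem pm).
rewrite (perm_big _ pm) /= big_cons bigcap_seq_cons B'i.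
have -> : \bigcap_(k in [set` J1 ++ J2]) f k @^-1` B' k = C.
  by apply: eq_bigcapr => k kJ; rewrite B'E.
have -> : (\prod_(k <- J1 ++ J2) P (f k @^-1` B' k))%E = p.
  by apply: eq_big_seq => k kJ; rewrite B'E.
apply => // k.
  by move=> kJ; rewrite B'E ?mem_cat ?kJ //; apply: mJ; rewrite mem_cat kJ.
rewrite inE => /orP[/eqP ->|kJ]; first by exists t.
by rewrite B'E ?mem_cat ?kJ ?orbT //; exact: hJ.
Qed.

End independence_of_rays.

(** * Pairs of independent uniform variables on the unit interval *)

Section unit_interval.
Context (R : realType).
Local Notation T := (lebesgueTypeR R).
Local Notation m := (@leb01 R).

Lemma borel_lebesgue (A : set R) : measurable A -> measurable (A : set T).
Proof. by move=> mA; apply: sub_caratheodory. Qed.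

Lemma leb01_itv (a b : R) : 0 <= a -> a <= b -> b <= 1 ->
  m `[a, b[%classic = (b - a)%:E.
Proof.
move=> a0 ab b1; rewrite /leb01 /mrestr.
have -> : `[a, b[%classic `&` @unit_itv R = `[a, b[%classic.
  apply/setIidPl => x /=; rewrite in_itv /= => /andP[ax xb].
  by rewrite /unit_itv /= (le_trans a0 ax) ltW // (lt_le_trans xb).
transitivity (@lebesgue_measure R `[a, b[%classic); first by [].
rewrite lebesgue_measure_itv /= lte_fin; case: ltgtP ab => [ab _|//|-> _].
  by rewrite EFinB.
by rewrite subrr.
Qed.

Lemma measurable_co01 : measurable (`[0, 1[%classic : set T).
Proof. by apply: borel_lebesgue; exact: measurable_itv. Qed.

(** The half-open interval has full mass. It is preferred to the closed one because at the endpoint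
    1 the cell number [truncn (q * x)] would be [q], one too many. *)
Lemma leb01_setI_co (A : set T) : measurable A ->
  m A = m (A `&` `[0, 1[%classic).
Proof.
move=> mA; have mI := measurable_co01.
rewrite (measureDI _ mA mI) [X in (X + _)%E](_ : _ = 0%E) ?add0e //.
apply/eqP; rewrite eq_le measure_ge0 andbT.
apply: (@le_trans _ _ (m (~` `[0, 1[%classic))).
  apply: le_measure; rewrite ?inE; first exact: measurableD.
    exact: measurableC.
  by move=> x [].
rewrite probability_setC // [X in (_ - X)%E](_ : _ = 1%E) ?subee //.
by have /= := leb01_itv (lexx 0) ler01 (lexx 1); rewrite subr0.
Qed.

Definition cell (q : nat) (Q : pred nat) : set T :=
  [set x : R | 0 <= x < 1 /\ Q (Num.truncn (q%:R * x))].

Lemma truncn_cell (q k : nat) (x : R) : (0 < q)%N -> 0 <= x ->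
  (Num.truncn (q%:R * x) = k) <-> (k%:R / q%:R <= x < k.+1%:R / q%:R).
Proof.
move=> q0 x0; have q0' : 0 < q%:R :> R by rewrite ltr0n.
rewrite ler_pdivrMr // ltr_pdivlMr // ![x * _]mulrC.
have y0 : 0 <= q%:R * x by rewrite mulr_ge0.
by split => [<-|/truncn_def //]; exact: truncn_itv.
Qed.

Lemma cellE q Q : (0 < q)%N -> cell q Q =
  \big[setU/set0]_(k < q)
    (if Q k then `[k%:R / q%:R, k.+1%:R / q%:R[%classic else set0).
Proof.
move=> q0; have q0' : 0 < q%:R :> R by rewrite ltr0n.
rewrite -(bigcup_mkord q (fun k =>
  if Q k then `[k%:R / q%:R, k.+1%:R / q%:R[%classic else set0)).
apply/seteqP; split => x.
  case=> /andP[x0 x1] Qx; exists (Num.truncn (q%:R * x)) => /=.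
    rewrite -(ltr_nat R) (le_lt_trans _ (_ : q%:R * x < _)) //.
      by rewrite truncn_le mulr_ge0.
    by rewrite gtr_pMr.
  by rewrite Qx /= in_itv /=; apply/truncn_cell.
case=> k /= kq; case: ifPn => // Qk; rewrite /= in_itv /= => kx.
have x0 : 0 <= x by case/andP: kx => + _; apply: le_trans; rewrite divr_ge0.
split; last by rewrite ((truncn_cell _ q0 x0).2 kx).
rewrite x0; case/andP: kx => _ /lt_le_trans; apply.
by rewrite ler_pdivrMr // mul1r ler_nat.
Qed.

Lemma measurable_cell q Q : (0 < q)%N -> measurable (cell q Q).
Proof.
move=> q0; rewrite cellE //; apply: bigsetU_measurable => k _.
by case: ifP => // _; apply: borel_lebesgue; exact: measurable_itv.
Qed.

Lemma leb01_cell q Q : (0 < q)%N ->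
  m (cell q Q) = ((\sum_(k < q) (Q k)%:R) / q%:R)%:E.
Proof.
move=> q0; have q0' : 0 < q%:R :> R by rewrite ltr0n.
pose F k : set T := if (k < q)%N && Q k
  then `[k%:R / q%:R, k.+1%:R / q%:R[%classic else set0.
have -> : cell q Q = \big[setU/set0]_(k < q) F k.
  by rewrite cellE //; apply: eq_bigr => k _; rewrite /F ltn_ord.
rewrite measure_bigsetU.
- rewrite mulr_suml -sumEFin; apply: eq_bigr => k _.
  rewrite /F ltn_ord /=; case: ifPn => Qk; last by rewrite measure0 mul0r.
  rewrite leb01_itv ?divr_ge0 ?ler_pM2r ?invr_gt0 ?ler_nat //.
    by rewrite -mulrBl -natrB // subSnn.
  by rewrite ler_pdivrMr // mul1r ler_nat.
- move=> k; rewrite /F; case: ifP => // _.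
  by apply: borel_lebesgue; exact: measurable_itv.
- move=> i j _ _ [x []]; rewrite /F.
  case: ifPn => // /andP[iq _]; case: ifPn => // /andP[jq _] /=.
  rewrite !in_itv /= => ix jx.
  have x0 : 0 <= x by case/andP: ix => + _; apply: le_trans; rewrite divr_ge0.
  by move/(truncn_cell _ q0 x0): ix => <-; move/(truncn_cell _ q0 x0): jx.
Qed.

End unit_interval.

(** * Splitting binary digits *)

Lemma sum_nat_mul2 (V : nmodType) p (G : nat -> V) :
  \sum_(k < p * 2) G k = \sum_(k < p) (G (k * 2)%N + G (k * 2).+1).
Proof.
elim: p => [|p IH]; first by rewrite !big_ord0.
by rewrite mulSn addnC addn2 !big_ord_recr /= IH !addrA.
Qed.

Lemma sum_nat_mul4 (V : nmodType) p (G : nat -> V) :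
  \sum_(k < p * 4) G k = \sum_(k < p)
    (G (k * 4)%N + G (k * 4).+1 + (G (k * 4).+2 + G (k * 4).+3)).
Proof.
elim: p => [|p IH]; first by rewrite !big_ord0.
rewrite mulSn addnC !addnS addn0 !big_ord_recr /= IH.
by rewrite !addrA.
Qed.

(* The two halves of the [2 n] lowest binary digits of a number: those in odd
   and those in even positions. *)
Fixpoint deinterleave (n k : nat) : nat * nat :=
  if n is n'.+1 then
    let p := deinterleave n' (k %/ 4) in
    ((p.1 * 2 + k %% 4 %/ 2)%N, (p.2 * 2 + k %% 2)%N)
  else (0, 0)%N.

(** The digit split is a bijection from the numbers below [4 ^ n] onto the pairs of numbers below
    [2 ^ n], put in summation form because it serves to count cells. One digit in base 4 gives one
    binary digit to each half, whence the induction. *)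
Lemma sum_deinterleave (V : nmodType) n (F : nat -> nat -> V) :
  \sum_(k < 4 ^ n) F (deinterleave n k).1 (deinterleave n k).2 =
  \sum_(a < 2 ^ n) \sum_(b < 2 ^ n) F a b.
Proof.
elim: n F => [|n IH] F; first by rewrite !big_ord1.
rewrite !expnSr (sum_nat_mul4 _ (fun k =>
  F (deinterleave n.+1 k).1 (deinterleave n.+1 k).2)).
rewrite (sum_nat_mul2 _ (fun a => \sum_(b < 2 ^ n * 2) F a b)).
under eq_bigr => k _.
  have e0 : deinterleave n.+1 (k * 4) =
    (((deinterleave n k).1 * 2)%N, ((deinterleave n k).2 * 2)%N).
    by rewrite /= mulnK // modnMl; congr pair; lia.
  have e1 : deinterleave n.+1 (k * 4).+1 =
    (((deinterleave n k).1 * 2)%N, ((deinterleave n k).2 * 2).+1).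
    have -> /= : (k * 4).+1 = (k * 4 + 1)%N by lia.
    by rewrite divnMDl // addn0; congr pair; lia.
  have e2 : deinterleave n.+1 (k * 4).+2 =
    (((deinterleave n k).1 * 2).+1, ((deinterleave n k).2 * 2)%N).
    have -> /= : (k * 4).+2 = (k * 4 + 2)%N by lia.
    by rewrite divnMDl // addn0; congr pair; lia.
  have e3 : deinterleave n.+1 (k * 4).+3 =
    (((deinterleave n k).1 * 2).+1, ((deinterleave n k).2 * 2).+1).
    have -> /= : (k * 4).+3 = (k * 4 + 3)%N by lia.
    by rewrite divnMDl // addn0; congr pair; lia.
  rewrite e0 e1 e2 e3 /=; over.
rewrite (IH (fun a b => F (a * 2)%N (b * 2)%N + F (a * 2)%N (b * 2).+1 +
  (F (a * 2).+1 (b * 2)%N + F (a * 2).+1 (b * 2).+1))).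
apply: eq_bigr => a _; rewrite (sum_nat_mul2 _ (F (a * 2)%N)).
by rewrite (sum_nat_mul2 _ (F (a * 2).+1)) -big_split.
Qed.

Section uniform_pair.
Context (R : realType).
Local Notation T := (lebesgueTypeR R).
Local Notation m := (@leb01 R).

Lemma truncn_mul_div (p : nat) (x : R) : (0 < p)%N -> 0 <= x ->
  (Num.truncn (p%:R * x) %/ p)%N = Num.truncn x.
Proof.
move=> p0 x0; apply/esym/truncn_def.
have p0' : 0 < p%:R :> R by rewrite ltr0n.
have /andP[le lt] : (Num.truncn (p%:R * x))%:R <= p%:R * x
    < (Num.truncn (p%:R * x)).+1%:R by rewrite truncn_itv // mulr_ge0.
set k := Num.truncn _ in le lt *; apply/andP; split.
  rewrite -(ler_pM2l p0') (le_trans _ le) // -natrM ler_nat mulnC.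
  exact: leq_divM.
rewrite -(ltr_pM2l p0') (lt_le_trans lt) // -natrM ler_nat mulnC.
by rewrite -ltn_divLR.
Qed.

(* A random variable given by its successive lower approximations at scale
   [1 / s n], read off the cell of level [n] that contains the point. *)
Definition digit_sup (q s : nat -> nat) (phi : nat -> nat -> nat) (x : T) : R :=
  if 0 <= x < 1 then
    sup [set (phi n (Num.truncn ((q n)%:R * x)))%:R / (s n)%:R | n in [set: nat]]
  else 0.

(** The bound [digit_lt] makes the supremum finite. By [digit_nd] the cells on which the
    approximation exceeds [t] increase with the level, so the probability of a ray is a limit of
    cell counts. *)
Record digit_process (q s : nat -> nat) (phi : nat -> nat -> nat) : Prop := {
  digit_q_gt0 : forall n, (0 < q n)%N;
  digit_s_gt0 : forall n, (0 < s n)%N;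
  digit_lt : forall n k, (phi n k < s n)%N;
  digit_nd : forall n (x : R), 0 <= x ->
    (phi n (Num.truncn ((q n)%:R * x)))%:R / (s n)%:R <=
    (phi n.+1 (Num.truncn ((q n.+1)%:R * x)))%:R / (s n.+1)%:R :> R
}.

Section digit_sup.
Context q s phi (H : digit_process q s phi).

Lemma digit_supP (t : R) x : 0 <= x < 1 -> t < digit_sup q s phi x <->
  exists n, t < (phi n (Num.truncn ((q n)%:R * x)))%:R / (s n)%:R.
Proof.
move=> x01; rewrite /digit_sup x01; split => [|[n]].
  case/sup_gt.
    by exists ((phi 0%N (Num.truncn ((q 0%N)%:R * x)))%:R / (s 0%N)%:R), 0%N.
  by move=> _ [n _ <-] tn; exists n.
move=> tn; apply: (lt_le_trans tn); apply: ub_le_sup; last by exists n.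
exists 1 => _ [k _ <-]; rewrite ler_pdivrMr ?mul1r ?ler_nat ?ltr0n //.
  exact/ltnW/(digit_lt H).
exact: (digit_s_gt0 H).
Qed.

Lemma digit_sup_ge0 x : 0 <= digit_sup q s phi x.
Proof.
case: (boolP (0 <= (x : R) < 1)) => x01; last by rewrite /digit_sup (negbTE x01).
rewrite leNgt; apply/negP => l0; move: (lexx (digit_sup q s phi x)).
apply/negP; rewrite -ltNge; apply/(digit_supP _ x01); exists 0%N.
by apply: (lt_le_trans l0); rewrite divr_ge0.
Qed.

Lemma digit_level (t : R) n (k : R) : 0 <= k < 1 ->
  t < (phi n (Num.truncn ((q n)%:R * k)))%:R / (s n)%:R ->
  forall n', (n <= n')%N ->
  t < (phi n' (Num.truncn ((q n')%:R * k)))%:R / (s n')%:R.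
Proof.
case/andP=> k0 _ tn; elim => [|n' IH]; first by rewrite leqn0 => /eqP <-.
rewrite leq_eqVlt => /orP[/eqP <- //|/IH h].
by apply: (lt_le_trans h); exact: (digit_nd H).
Qed.

Lemma digit_sup_ray (t : R) :
  digit_sup q s phi @^-1` `]t, +oo[ `&` `[0, 1[%classic =
  \bigcup_n cell (q n) (fun k => t < (phi n k)%:R / (s n)%:R).
Proof.
apply/seteqP; split => x /=.
  rewrite !in_itv /= andbT => -[h x01]; have [n hn] := (digit_supP t x01).1 h.
  by exists n.
case=> n _ [x01 hn]; rewrite !in_itv /= andbT; split => //.
by apply/(digit_supP t x01); exists n.
Qed.

Lemma measurable_digit_sup : measurable_fun setT (digit_sup q s phi).
Proof.
apply: (measurability _ (RGenOInfty.measurableE R)) => //.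
move=> _ [_ [t ->] <-]; rewrite setTI.
have mc : measurable (digit_sup q s phi @^-1` `]t, +oo[ `&` `[0, 1[%classic).
  rewrite digit_sup_ray; apply: bigcup_measurable => n _.
  exact/measurable_cell/(digit_q_gt0 H).
case: (ltP t 0) => t0.
  rewrite (_ : _ @^-1` _ = setT) //; apply/seteqP; split => x //= _.
  by rewrite in_itv /= andbT (lt_le_trans t0) // digit_sup_ge0.
rewrite (_ : _ @^-1` _ = digit_sup q s phi @^-1` `]t, +oo[ `&` `[0, 1[%classic) //.
apply/seteqP; split => x /=; last by case.
rewrite !in_itv /= andbT => h; split => //; apply/negPn/negP => x01.
by move: h; rewrite /digit_sup (negbTE x01) ltNge t0.
Qed.

End digit_sup.

Lemma leb01_digit_sup_cvg q s phi (H : digit_process q s phi) (t : R) :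
  (m \o (fun n => cell (q n) (fun k => t < (phi n k)%:R / (s n)%:R))) x
    @[x --> \oo] --> m (digit_sup q s phi @^-1` `]t, +oo[).
Proof.
rewrite leb01_setI_co ?(digit_sup_ray H); last first.
  by rewrite -[X in measurable X]setTI; apply: measurable_digit_sup.
apply: nondecreasing_cvg_mu => [n||n n' nn'].
- exact/measurable_cell/(digit_q_gt0 H).
- by apply: bigcup_measurable => n _; exact/measurable_cell/(digit_q_gt0 H).
- by apply/subsetPset => x [x01 h]; split => //; exact: (digit_level H) nn'.
Qed.

End uniform_pair.

(** * Joint law of the odd and even binary digits *)

Section uniform_pair_law.
Context (R : realType).
Local Notation T := (lebesgueTypeR R).
Local Notation m := (@leb01 R).

Let q4 (n : nat) := (4 ^ n)%N.
Let q2 (n : nat) := (2 ^ n)%N.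
Let bitU n k := (deinterleave n k).1.
Let bitV n k := (deinterleave n k).2.
(** The remainder secures the bound [digit_lt] for every [k], also for cell numbers of points beyond
    1. *)
Let bitI n k := (k %% 2 ^ n)%N.

Let deinterleave_lt n k :
  ((deinterleave n k).1 < 2 ^ n)%N /\ ((deinterleave n k).2 < 2 ^ n)%N.
Proof.
by elim: n k => [|n IH] k //=; have [] := IH (k %/ 4)%N; rewrite expnS; lia.
Qed.

Let ratio_le (a b n : nat) : (a * 2 <= b)%N ->
  a%:R / (2 ^ n)%:R <= b%:R / (2 ^ n.+1)%:R :> R.
Proof.
move=> ab; rewrite ler_pdivrMr ?ltr0n ?expn_gt0 // mulrAC.
rewrite ler_pdivlMr ?ltr0n ?expn_gt0 // -!natrM ler_nat expnS; nia.
Qed.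

Lemma digit_process_U : @digit_process R q4 q2 bitU.
Proof.
split=> [n|n|n k|n x x0]; rewrite ?expn_gt0 //.
  exact: (deinterleave_lt n k).1.
apply: ratio_le; rewrite /bitU /q4 expnS natrM -mulrA /= truncn_mul_div ?leq_addr //.
by rewrite mulr_ge0.
Qed.

Lemma digit_process_V : @digit_process R q4 q2 bitV.
Proof.
split=> [n|n|n k|n x x0]; rewrite ?expn_gt0 //.
  exact: (deinterleave_lt n k).2.
apply: ratio_le; rewrite /bitV /q4 expnS natrM -mulrA /= truncn_mul_div ?leq_addr //.
by rewrite mulr_ge0.
Qed.

Lemma digit_process_I : @digit_process R q2 q2 bitI.
Proof.
split=> [n|n|n k|n x x0]; rewrite ?expn_gt0 //.
  by rewrite ltn_mod expn_gt0.
apply: ratio_le; rewrite /bitI /q2.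
have <- : (Num.truncn ((2 ^ n.+1)%:R * x) %/ 2)%N = Num.truncn ((2 ^ n)%:R * x).
  by rewrite expnS natrM -mulrA truncn_mul_div // mulr_ge0.
by rewrite expnSr modn_divl leq_divM.
Qed.

Let U := digit_sup q4 q2 bitU : T -> R.
Let V := digit_sup q4 q2 bitV : T -> R.
(** This is the identity of [[0, 1[], written as a digit process so that its ray probabilities are
    limits of the same counts as those of [U] and [V]. *)
Let I := digit_sup q2 q2 bitI : T -> R.

Let mU : measurable_fun setT U. Proof. exact: measurable_digit_sup digit_process_U. Qed.
Let mV : measurable_fun setT V. Proof. exact: measurable_digit_sup digit_process_V. Qed.
Let mI : measurable_fun setT I. Proof. exact: measurable_digit_sup digit_process_I. Qed.

Let mpre (f : T -> R) (A : set R) : measurable_fun setT f -> measurable A ->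
  measurable (f @^-1` A).
Proof. by move=> mf mA; rewrite -[X in measurable X]setTI; exact: mf. Qed.

Let I_id (x : R) : 0 <= x < 1 -> I x = x.
Proof.
move=> x01; have /andP[x0 x1] := x01.
have bitIE n : bitI n (Num.truncn ((q2 n)%:R * x)) = Num.truncn ((q2 n)%:R * x).
  rewrite /bitI modn_small // -(ltr_nat R).
  apply: (@le_lt_trans _ _ ((q2 n)%:R * x)); first by rewrite truncn_le mulr_ge0.
  by rewrite gtr_pMr ?ltr0n ?expn_gt0.
have H t : t < I x <-> t < x.
  rewrite (digit_supP digit_process_I t x01); split.
    case=> n; rewrite bitIE => /lt_le_trans; apply.
    by rewrite ler_pdivrMr ?ltr0n ?expn_gt0 // mulrC truncn_le mulr_ge0.
  rewrite -subr_gt0 => tx.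
  (* Then [2 ^ n] exceeds the reciprocal of the gap [x - t], so the truncation error at level [n] is
     smaller than the gap. *)
  pose n := Num.truncn (x - t)^-1; exists n; rewrite bitIE.
  have q0 : 0 < (q2 n)%:R :> R by rewrite ltr0n expn_gt0.
  rewrite ltr_pdivlMr //.
  have h1 := truncnS_gt ((q2 n)%:R * x).
  have h2 : 1 < (x - t) * (q2 n)%:R.
    rewrite mulrC -ltr_pdivrMr // mul1r (lt_le_trans (truncnS_gt _)) //.
    by rewrite ler_nat -/n ltn_expl.
  by rewrite -addn1 natrD in h1; nra.
apply/eqP; rewrite eq_le !leNgt.
by apply/andP; split; apply/negP => /H; rewrite ltxx.
Qed.

Let I_law (A : set R) : measurable A -> m (I @^-1` A) = m A.
Proof.
move=> mA; rewrite leb01_setI_co; last exact: mpre.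
rewrite [RHS]leb01_setI_co; last exact: borel_lebesgue.
congr (m _); apply/seteqP; split => x /= [];
  by rewrite in_itv /= => h x01; split => //; move: h; rewrite I_id.
Qed.

Let count (n : nat) (t : R) : R :=
  (\sum_(a < 2 ^ n) (t < (a : nat)%:R / (q2 n)%:R)%R%:R) / (q2 n)%:R.

Let count_cvg (t : R) : (count n t)%:E @[n --> \oo] --> m (I @^-1` `]t, +oo[).
Proof.
have := leb01_digit_sup_cvg (t := t) digit_process_I.
apply: cvg_trans; apply: near_eq_cvg; apply: nearW => n /=.
rewrite leb01_cell ?expn_gt0 // /count; congr (_ / _)%:E.
by apply: eq_bigr => a _; rewrite /bitI modn_small.
Qed.

(** Among the [4 ^ n] cells of level [n], the number satisfying both conditions is a product of two
    counts out of [2 ^ n], by the bijection of digits. The claim is the limit of this identity. *)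
Let joint_ray (s t : R) :
  m (U @^-1` `]s, +oo[ `&` V @^-1` `]t, +oo[) =
  (m (I @^-1` `]s, +oo[) * m (I @^-1` `]t, +oo[))%E.
Proof.
pose Q n k := (s < (bitU n k)%:R / (q2 n)%:R) && (t < (bitV n k)%:R / (q2 n)%:R).
have mUV : measurable (U @^-1` `]s, +oo[ `&` V @^-1` `]t, +oo[).
  by apply: measurableI; exact: mpre.
have mc n : measurable (@cell R (q4 n) (Q n)).
  by apply: measurable_cell; rewrite expn_gt0.
have E : U @^-1` `]s, +oo[ `&` V @^-1` `]t, +oo[ `&` `[0, 1[%classic =
    \bigcup_n cell (q4 n) (Q n).
  apply/seteqP; split => x /=.
    rewrite !in_itv /= !andbT => -[[hU hV] x01].
    have [n hn] := (digit_supP digit_process_U s x01).1 hU.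
    have [n' hn'] := (digit_supP digit_process_V t x01).1 hV.
    (* The two conditions are met at different levels; both persist at all later ones. *)
    exists (maxn n n') => //; split => //; apply/andP; split.
      exact: (digit_level digit_process_U x01 hn (leq_maxl _ _)).
    exact: (digit_level digit_process_V x01 hn' (leq_maxr _ _)).
  case=> n _ [x01 /andP[hU hV]]; rewrite !in_itv /= !andbT; split => //; split.
    by apply/(digit_supP digit_process_U s x01); exists n.
  by apply/(digit_supP digit_process_V t x01); exists n.
have c1 : (m \o (fun n => cell (q4 n) (Q n))) n @[n --> \oo] -->
    m (U @^-1` `]s, +oo[ `&` V @^-1` `]t, +oo[).
  rewrite leb01_setI_co // E; apply: nondecreasing_cvg_mu => //.
    by apply: bigcup_measurable => n _; exact: mc.
  move=> n n' nn'; apply/subsetPset => x [x01 /andP[hU hV]]; split => //.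
  apply/andP; split.
    exact: (digit_level digit_process_U x01 hU nn').
  exact: (digit_level digit_process_V x01 hV nn').
apply: (cvg_unique _ c1) => //.
have : ((count n s)%:E * (count n t)%:E)%E @[n --> \oo] -->
    (m (I @^-1` `]s, +oo[) * m (I @^-1` `]t, +oo[))%E.
  apply: cvgeM; [|exact: count_cvg|exact: count_cvg].
  by apply: mule_def_fin; apply: fin_num_measure; exact: mpre.
apply: cvg_trans; apply: near_eq_cvg; apply: nearW => n /=.
rewrite leb01_cell ?expn_gt0 // -EFinM /count; congr _%:E.
rewrite (sum_deinterleave n (fun a b => ((s < a%:R / (q2 n)%:R) &&
  (t < b%:R / (q2 n)%:R))%R%:R : R)).
rewrite mulrACA -invfM -natrM -expnMn; congr (_ / _).
rewrite mulr_suml; apply: eq_bigr => a _; rewrite mulr_sumr.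
by apply: eq_bigr => b _; rewrite -natrM mulnb.
Qed.

(** Rays become Borel sets one coordinate at a time: each time a restricted measure is compared with
    a scaled one. *)
Let joint_borel (A B : set R) : measurable A -> measurable B ->
  m (U @^-1` A `&` V @^-1` B) = (m A * m B)%E.
Proof.
move=> mA mB; rewrite -(I_law mA) -(I_law mB).
have mVB := mpre mV mB.
have mIA := mpre mI mA.
have scale (C : set T) : measurable C -> exists r : {nonneg R}, r%:num%:E = m C.
  move=> mC; exists (NngNum (fine_ge0 (measure_ge0 m C))) => /=.
  by rewrite fineK // fin_num_measure.
suff hs s : m (U @^-1` `]s, +oo[ `&` V @^-1` B) =
    (m (I @^-1` `]s, +oo[) * m (I @^-1` B))%E.
  have [r rE] := scale _ (mpre mI mB).
  rewrite -rE muleC.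
  apply: (@ray_unique _ _ _ _ _ (mrestr m mVB) (mscale r m) U I) => // s.
  by rewrite /= /mrestr /mscale rE hs muleC.
have mUs : measurable (U @^-1` `]s, +oo[) by exact: mpre.
have [r rE] := scale _ (mpre mI (measurable_itv `]s, +oo[)).
rewrite -rE setIC.
apply: (@ray_unique _ _ _ _ _ (mrestr m mUs) (mscale r m) V I) => // t.
by rewrite /= /mrestr /mscale rE setIC joint_ray.
Qed.

Lemma borel_uniform_pair : exists U V : T -> R,
  [/\ measurable_fun setT U, measurable_fun setT V &
    forall A B : set R, measurable A -> measurable B ->
      m (U @^-1` A `&` V @^-1` B) = (m A * m B)%E].
Proof. by exists U, V. Qed.

End uniform_pair_law.

(** * From Borel sets to Lebesgue sets *)

Section lebesgue_uniform_pair.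
Context (R : realType).
Local Notation T := (lebesgueTypeR R).
Local Notation m := (@leb01 R).

Lemma leb01_le (A : set T) : measurable A ->
  (m A <= @completed_lebesgue_measure R A)%E.
Proof.
move=> mA; rewrite /leb01 /mrestr; apply: le_measure; rewrite ?inE //.
by apply: measurableI => //; exact: measurable_unit_itv.
Qed.

Lemma lebesgue_sandwich (B : set T) : measurable B -> exists B0 B1 : set R,
  [/\ measurable B0, measurable B1, B0 `<=` B, B `<=` B1 &
      @completed_lebesgue_measure R (B1 `\` B0) = 0%E].
Proof.
move=> mB; have : completed_algebra_gen (@lebesgue_measure R) B.
  rewrite -g_sigma_completed_algebra_genE.
  by rewrite completed_caratheodory_measurable.
case=> /= B0 mB0 [N [F [mF F0 NF]] <-].
exists B0, (B0 `|` F); split => //.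
- exact: measurableU.
- by apply: setUS.
- transitivity (@lebesgue_measure R ((B0 `|` F) `\` B0)); first by [].
  apply/eqP; rewrite eq_le measure_ge0 andbT -F0.
  apply: le_measure; rewrite ?inE //; first by apply: measurableD => //; exact: measurableU.
  by move=> x [[]].
Qed.

Lemma leb01_sandwich (B0 B1 : set R) : measurable B0 -> measurable B1 ->
  B0 `<=` B1 -> @completed_lebesgue_measure R (B1 `\` B0) = 0%E -> m B1 = m B0.
Proof.
move=> mB0 mB1 B01 h; rewrite -(setDUK B01); apply: measureU0.
- exact: borel_lebesgue.
- by apply: borel_lebesgue; exact: measurableD.
- apply/eqP; rewrite eq_le measure_ge0 andbT -h.
  by apply: leb01_le; apply: borel_lebesgue; exact: measurableD.
Qed.

(* [leb01] is not complete off [0, 1], hence the truncation of [f] there. *)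
Lemma measurable_lebesgue_lebesgue (f : T -> R) : measurable_fun setT f ->
  (forall A : set R, measurable A -> m (f @^-1` A) = m A) ->
  measurable_fun setT ((fun x => if 0 <= (x : R) <= 1 then f x else 0) : T -> T).
Proof.
move=> mf lf _ B mB; rewrite setTI.
have [B0 [B1 [mB0 mB1 B0B BB1 h]]] := lebesgue_sandwich mB.
have mu1 := @measurable_unit_itv R.
have mp (A : set R) : measurable A -> measurable (f @^-1` A).
  by move=> mA; rewrite -[X in measurable X]setTI; exact: mf.
(* This set lies in the preimage of the null Borel set between [B0] and [B1], which is null because
   [f] preserves the measure; completeness of Lebesgue measure does the rest. *)
have mD : measurable (f @^-1` (B `\` B0) `&` @unit_itv R).
  apply: (@completed_lebesgue_measure_is_complete R).
  exists (f @^-1` (B1 `\` B0) `&` @unit_itv R); split.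
  - by apply: measurableI => //; apply: mp; exact: measurableD.
  - transitivity (m (f @^-1` (B1 `\` B0))); first by [].
    rewrite lf; last exact: measurableD.
    apply/eqP; rewrite eq_le measure_ge0 andbT -h.
    by apply: leb01_le; apply: borel_lebesgue; exact: measurableD.
  - by move=> x [[Bx B0x] x01]; split => //; split => //; exact: BB1.
rewrite (_ : _ @^-1` B = f @^-1` B0 `&` @unit_itv R `|`
    (f @^-1` (B `\` B0) `&` @unit_itv R) `|`
    (if pselect (B 0) then ~` @unit_itv R else set0)).
  apply: measurableU; first by apply: measurableU => //; apply: measurableI => //; exact: mp.
  by case: pselect => /= h0; [exact: measurableC|exact: measurable0].
apply/seteqP; split => x /=.
  case: ifPn => x01 Bx.
    by left; have [?|?] := pselect (B0 (f x)); [left|right].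
  by right; case: pselect => //= b0; exact/negP.
case=> [[[h1 h2]|[[h1 _] h2]]|].
- by rewrite /unit_itv /= in h2; rewrite h2; exact: B0B.
- by rewrite /unit_itv /= in h2; rewrite h2.
- case: pselect => //= b0; rewrite /unit_itv /=.
  by case: ifP.
Qed.

(** Lebesgue sets are needed in the target: [V] gets iterated, and Lebesgue measurable functions are
    composed with the resulting points. Squeezing each set between two Borel sets of equal measure
    transfers the product formula. *)
Lemma uniform_pair : exists U V : T -> T,
  [/\ measurable_fun setT U, measurable_fun setT V &
    forall A B : set T, measurable A -> measurable B ->
      m (U @^-1` A `&` V @^-1` B) = (m A * m B)%E].
Proof.
have [U [V [mU mV UV]]] := borel_uniform_pair R.
have lU (A : set R) : measurable A -> m (U @^-1` A) = m A.
  move=> mA; have := UV A setT mA measurableT.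
  by rewrite preimage_setT setIT probability_setT mule1.
have lV (A : set R) : measurable A -> m (V @^-1` A) = m A.
  move=> mA; have := UV setT A measurableT mA.
  by rewrite preimage_setT setTI probability_setT mul1e.
pose cut (f : T -> R) : T -> T := fun x => if 0 <= (x : R) <= 1 then f x else 0.
have mcU : measurable_fun setT (cut U) by exact: measurable_lebesgue_lebesgue.
have mcV : measurable_fun setT (cut V) by exact: measurable_lebesgue_lebesgue.
have cutUV (A B : set T) : m (cut U @^-1` A `&` cut V @^-1` B) =
    m (U @^-1` A `&` V @^-1` B).
  rewrite /leb01 /mrestr; congr (_ _); apply/seteqP.
  by split => x [] + x01; rewrite /unit_itv /= in x01; rewrite /= /cut x01.
exists (cut U), (cut V); split => // A B mA mB.
have [A0 [A1 [mA0 mA1 A0A AA1 hA]]] := lebesgue_sandwich mA.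
have [B0 [B1 [mB0 mB1 B0B BB1 hB]]] := lebesgue_sandwich mB.
have eA := leb01_sandwich mA0 mA1 (subset_trans A0A AA1) hA.
have eB := leb01_sandwich mB0 mB1 (subset_trans B0B BB1) hB.
have mI (C D : set T) : measurable C -> measurable D ->
    measurable (cut U @^-1` C `&` cut V @^-1` D).
  by move=> mC mD; apply: measurableI;
    rewrite -[X in measurable X]setTI; [exact: mcU|exact: mcV].
have between (C0 C C1 : set T) : measurable C0 -> measurable C -> measurable C1 ->
    C0 `<=` C -> C `<=` C1 -> m C1 = m C0 -> m C = m C0.
  move=> ? ? ? h0 h1 e; apply/eqP; rewrite eq_le.
  by apply/andP; split; [rewrite -e|]; apply: le_measure; rewrite ?inE.
rewrite (between A0 A A1) ?(between B0 B B1) //; try exact: borel_lebesgue.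
rewrite -(UV A0 B0) // -cutUV.
apply: (between _ _ (cut U @^-1` A1 `&` cut V @^-1` B1)).
- by apply: mI; exact: borel_lebesgue.
- exact: mI.
- by apply: mI; exact: borel_lebesgue.
- by move=> x [/A0A ? /B0B ?].
- by move=> x [/AA1 ? /BB1 ?].
- by rewrite !cutUV !UV // eA eB.
Qed.

End lebesgue_uniform_pair.

(** * Poisson points *)

Lemma independent_classes_extend d (T : measurableType d) (R : realType)
    (P : probability T R) (I : eqType) (C : I -> set (set T)) :
  (forall i, C i setT) ->
  (forall J : seq I, uniq J -> exists J' : seq I, [/\ uniq J', {subset J <= J'} &
    forall E : I -> set T, (forall i, C i (E i)) ->
      P (\bigcap_(i in [set` J']) E i) = (\prod_(i <- J') P (E i))%E]) ->
  independent_classes P C.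
Proof.
move=> CT H J E uJ CE; have [J' [uJ' JJ' {}H]] := H J uJ.
pose E' i := if i \in J then E i else setT.
have := H E'; rewrite /E'.
have -> : \bigcap_(i in [set` J']) (if i \in J then E i else setT) =
    \bigcap_(i in [set` J]) E i.
  apply/seteqP; split => x h i /=.
    by move=> iJ; have := h i (JJ' _ iJ); rewrite iJ.
  by move=> _; case: ifPn => // /h.
move=> ->; last by move=> i; case: ifPn => // /CE.
rewrite (eq_bigr (fun i => if i \in J then P (E i) else 1%E)); last first.
  by move=> i _; case: ifP => // _; rewrite probability_setT.
rewrite -big_mkcond /= -big_filter; apply: perm_big.
apply: uniq_perm => //; first exact: filter_uniq.
by move=> i; rewrite mem_filter; apply/andb_idr/JJ'.
Qed.

Section iid_points.
Context (R : realType).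
Local Notation T := (lebesgueTypeR R).
Local Notation m := (@leb01 R).

(** A uniform point splits into an independent pair: [U] is the first output, and [V], again
    uniform, is split in turn. All later outputs are functions of [V], so the product formula for
    the pair gives the induction on [n]. *)
Lemma iid_uniform : exists xi : nat -> T -> T,
  (forall j, measurable_fun setT (xi j)) /\
  forall n (B : nat -> set T), (forall j, measurable (B j)) ->
    m [set x | forall j, (j < n)%N -> B j (xi j x)] = (\prod_(j < n) m (B j))%E.
Proof.
have [U [V [mU mV UV]]] := uniform_pair R.
pose xi j := U \o iter j V.
have mxi j : measurable_fun setT (xi j).
  apply: measurableT_comp => //; elim: j => [|j IH]; first exact: measurable_id.
  exact: measurableT_comp mV IH.
exists xi; split => //; elim=> [|n IH] B mB.
  by rewrite big_ord0 -[RHS](probability_setT m); congr (m _); apply/seteqP; split.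
rewrite big_ord_recl -(IH (fun j => B j.+1)) // -UV //.
  congr (m _); apply/seteqP; split => x /=.
    move=> h; split => [|j jn]; first exact: (h 0%N).
    by have := h j.+1; rewrite /xi /= -iterSr; apply.
  case=> h0 h [|j] jn //; have := h j jn.
  by rewrite /xi /= -iterSr.
rewrite (_ : mkset _ = \bigcap_(j in `I_n) xi j @^-1` B j.+1).
  apply: bigcap_measurableType => j _.
  by rewrite -[X in measurable X]setTI; exact: mxi.
by apply/seteqP; split => x h j /= /h.
Qed.

(** The quantile transform: consecutive intervals with the masses of [Q] as lengths. *)
Lemma nat_quantile (Q : probability nat R) : exists nu : T -> nat,
  measurable_fun setT nu /\ forall n, m (nu @^-1` [set n]) = Q [set n].
Proof.
pose S n := fine (Q `I_n).
have SE n : (S n)%:E = Q `I_n by rewrite fineK // fin_num_measure.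
have S0 : S 0%N = 0 by rewrite /S II0 measure0.
have SS n : (S n.+1)%:E = ((S n)%:E + Q [set n])%E.
  rewrite !SE IIS measureU //; apply/seteqP; split => x //= -[/= xn xe].
  by rewrite xe ltnn in xn.
have Qn n : Q [set n] = (S n.+1 - S n)%:E.
  by rewrite EFinB SS addeAC subee // add0e.
have SleS n : S n <= S n.+1 by rewrite -subr_ge0 -lee_fin -Qn measure_ge0.
have Sle : {homo S : n n' / (n <= n')%N >-> n <= n'}.
  by apply: homo_leq => //; exact: le_trans.
have S_ge0 n : 0 <= S n by rewrite -S0; exact: Sle.
have S_le1 n : S n <= 1 by rewrite -lee_fin SE probability_le1.
pose I n : set T := `[S n, S n.+1[%classic.
have mI n : measurable (I n) by apply: borel_lebesgue; exact: measurable_itv.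
have uI x n n' : I n x -> I n' x -> n = n'.
  rewrite /I /= !in_itv /= => /andP[a b] /andP[a' b'].
  have [nn'|n'n|//] := ltngtP n n'.
    by have := lt_le_trans b (le_trans (Sle _ _ nn') a'); rewrite ltxx.
  by have := lt_le_trans b' (le_trans (Sle _ _ n'n) a); rewrite ltxx.
have lI n : m (I n) = Q [set n] by rewrite leb01_itv // Qn.
pose D := \bigcup_n I n.
have mD : measurable D by apply: bigcup_measurable.
have D0 : m (~` D) = 0%E.
  rewrite probability_setC //= (_ : leb01 D = 1%E) ?subee //.
  rewrite /D measure_bigcup //; last by move=> i j _ _ [x []]; exact: uI.
  transitivity (Q (\bigcup_n [set n])).
    rewrite measure_bigcup //; last by move=> i j _ _ [x [-> ->]].
    by apply: eq_eseriesr => n _; exact: lI.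
  rewrite -[RHS](probability_setT Q); congr (Q _).
  by rewrite -subTset => n _; exists n.
(* Off the union [D] of the intervals the default value 0 is taken; this affects a null set, which
   [nuE] adds to the preimage of 0. *)
pose nu (x : T) := xget 0%N [set n | I n x].
have nuI n x : I n x -> nu x = n.
  move=> Ix; rewrite /nu; case: xgetP => [k _ Ik|/(_ n) //]; exact: uI Ik Ix.
have nuE n : nu @^-1` [set n] = I n `|` (if n is 0%N then ~` D else set0).
  apply/seteqP; split => x /=.
    move=> <-; have [[k _ Ik]|nD] := pselect (D x); first by left; rewrite (nuI k).
    right; rewrite (_ : nu x = 0%N) //.
    by rewrite /nu; case: xgetP => // k _ Ik; case: nD; exists k.
  case=> [|]; first exact: nuI.
  case: n => // nD; rewrite /nu; case: xgetP => // k _ Ik.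
  by case: nD; exists k.
have mnu n : measurable (nu @^-1` [set n]).
  rewrite nuE; apply: measurableU => //.
  by case: n => [|n] //; exact: measurableC.
exists nu; split => [_ A _|n].
  rewrite setTI (_ : nu @^-1` A = \bigcup_(n in A) nu @^-1` [set n]).
    by apply: bigcup_measurable.
  apply/seteqP; split => x /= => [h|[n An /= e]]; first by exists (nu x).
  by rewrite e.
rewrite nuE -lI; case: n => [|n]; last by rewrite setU0.
by rewrite measureU0 //; exact: measurableC.
Qed.

Lemma poisson_points : exists (N : T -> nat) (Y : nat -> T -> T),
  [/\ measurable_fun setT N, forall k, measurable_fun setT (Y k),
    forall n, m (N @^-1` [set n]) = (poisson_pmf 1 n)%:E &
    forall n (A : set nat) (B : nat -> set T), (forall j, measurable (B j)) ->
      m (N @^-1` A `&` [set x | forall j, (j < n)%N -> B j (Y j x)]) =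
      (m (N @^-1` A) * \prod_(j < n) m (B j))%E].
Proof.
have [xi [mxi hxi]] := iid_uniform.
have [nu [mnu hnu]] := nat_quantile (poisson_prob 1 0).
have lxi0 (B : set T) : measurable B -> m (xi 0%N @^-1` B) = m B.
  move=> mB; have := hxi 1%N (fun=> B) (fun=> mB); rewrite big_ord1 => <-.
  by congr (m _); apply/seteqP; split => [x h [|]//|x /(_ 0%N)]; exact.
have mnuA (A : set nat) : measurable (nu @^-1` A).
  by rewrite -[X in measurable X]setTI; exact: mnu.
(* The first uniform variable drives the count and the remaining ones are the points, so the count
   is independent of the points. *)
exists (nu \o xi 0%N), (fun k => xi k.+1); split => //.
- exact: measurableT_comp.
- move=> n; rewrite comp_preimage lxi0 //.
  by rewrite hnu /= /poisson_prob ltr01 esum_set1 // lee_fin poisson_pmf_ge0.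
- move=> n A B mB; rewrite comp_preimage lxi0 //.
  have := hxi n.+1 (fun j => if j is j'.+1 then B j' else nu @^-1` A).
  rewrite big_ord_recl /= => <-; last by case.
  congr (m _); apply/seteqP; split => x /=.
    by case=> h0 h [|j] //; exact: h.
  by move=> h; split => [|j jn]; [exact: (h 0%N)|exact: (h j.+1)].
Qed.

End iid_points.

(** * Norm bounds in a symmetric space *)

Lemma ae_measure d (T : measurableType d) (R : realType)
    (mu : {measure set T -> \bar R}) (A B : set T) :
  measurable A -> measurable B -> {ae mu, forall t, A t <-> B t} -> mu A = mu B.
Proof.
move=> mA mB [N [mN N0 hN]].
have le (C D : set T) : measurable C -> measurable D ->
    (forall t, ~ N t -> C t -> D t) -> (mu C <= mu D)%E.
  move=> mC mD CD; rewrite -(measureU0 mD mN N0).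
  apply: le_measure; rewrite ?inE //; first exact: measurableU.
  by move=> t Ct; have [?|nN] := pselect (N t); [right|left; exact: CD].
have hAB t : ~ N t -> (A t <-> B t) by move=> nN; apply: contrapT => /hN.
by apply/eqP; rewrite eq_le !le // => t /hAB [].
Qed.

Section norm_le.
Context (R : realType) (X : symmetric_space R).
Local Notation T := (lebesgueTypeR R).
Local Notation m := (@leb01 R).

Implicit Types (f g : T -> R) (c : R).

(** Membership in [X] together with a norm bound, as a predicate on functions: estimates can then be
    chained on functions, up to a.e. equality, without naming elements of [X]. *)
Definition norm_le (g : T -> R) (c : R) : Prop :=
  exists2 z : X, {ae m, forall t, ss_fun z t = g t} & `|z| <= c.

Lemma ss_funP (a : R) (x y : X) :
  {ae m, forall t, ss_fun (a *: x + y) t = a * ss_fun x t + ss_fun y t}.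
Proof. by have := ss_fun_linear a x y; apply: filterS => t; apply. Qed.

Lemma ss_fun0 : {ae m, forall t, ss_fun (0 : X) t = 0}.
Proof.
have := ss_funP (-1) (0 : X) 0; rewrite scaler0 add0r.
by apply: filterS => t ->; rewrite mulN1r addNr.
Qed.

Lemma ss_funZ (a : R) (x : X) : {ae m, forall t, ss_fun (a *: x) t = a * ss_fun x t}.
Proof.
have h := ss_funP a x 0; rewrite addr0 in h.
by apply: filterS2 h ss_fun0 => t -> ->; rewrite addr0.
Qed.

Lemma ss_funD (x y : X) : {ae m, forall t, ss_fun (x + y) t = ss_fun x t + ss_fun y t}.
Proof.
by have := ss_funP 1 x y; rewrite scale1r; apply: filterS => t ->; rewrite mul1r.
Qed.

Lemma ss_funB (x y : X) : {ae m, forall t, ss_fun (x - y) t = ss_fun x t - ss_fun y t}.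
Proof.
have := ss_funP (-1) y x; rewrite scaleN1r addrC; apply: filterS => t ->.
by rewrite mulN1r addrC.
Qed.

Lemma ss_fun_sum (I : Type) (s : seq I) (a : I -> R) (x : I -> X) :
  {ae m, forall t, ss_fun (\sum_(i <- s) a i *: x i) t =
                   \sum_(i <- s) a i * ss_fun (x i) t}.
Proof.
elim: s => [|i s IH].
  by rewrite big_nil; apply: filterS ss_fun0 => t ->; rewrite big_nil.
rewrite big_cons.
have := ss_funP (a i) (x i) (\sum_(j <- s) a j *: x j).
apply: filterS2 IH => t -> ->.
by rewrite big_cons.
Qed.

Lemma ss_fun_eq (x y : X) : {ae m, forall t, ss_fun x t = ss_fun y t} -> x = y.
Proof.
move=> xy; apply/eqP; rewrite -subr_eq0; apply/eqP/ss_fun_inj.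
by apply: filterS2 xy (ss_funB x y) => t e -> _; rewrite e subrr.
Qed.

Lemma norm_le_fun (z : X) : norm_le (ss_fun z) `|z|.
Proof. by exists z => //; apply: aeW. Qed.

Lemma norm_leE (z : X) (g : T -> R) c :
  {ae m, forall t, ss_fun z t = g t} -> norm_le g c -> `|z| <= c.
Proof.
move=> zg [y yg yc]; rewrite (@ss_fun_eq z y) //.
by apply: filterS2 zg yg => t -> ->.
Qed.

Lemma norm_le_trans g c c' : c <= c' -> norm_le g c -> norm_le g c'.
Proof. by move=> cc' [z zg zc]; exists z => //; apply: le_trans cc'. Qed.

Lemma norm_le_ge0 g c : norm_le g c -> 0 <= c.
Proof. by case=> z _; apply: le_trans. Qed.

Lemma norm_le_eq f g c : {ae m, forall t, f t = g t} -> norm_le f c -> norm_le g c.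
Proof.
by move=> fg [z zf zc]; exists z => //; apply: filterS2 fg zf => t <-.
Qed.

Lemma norm_leZ (a : R) g c : norm_le g c -> norm_le (fun t => a * g t) (`|a| * c).
Proof.
case=> z zg zc; exists (a *: z); last by rewrite normrZ ler_wpM2l.
by apply: filterS2 (ss_funZ a z) zg => t -> ->.
Qed.

Lemma norm_leD f g c c' : norm_le f c -> norm_le g c' ->
  norm_le (fun t => f t + g t) (c + c').
Proof.
case=> y yf yc [z zg zc]; exists (y + z).
  by apply: filterS3 (ss_funD y z) yf zg => t -> -> ->.
by rewrite (le_trans (ler_normD _ _)) // lerD.
Qed.

Lemma norm_le_ideal f g c : measurable_fun setT f ->
  {ae m, forall t, `|f t| <= `|g t|} -> norm_le g c -> norm_le f c.
Proof.
move=> mf fg [z zg zc].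
pose F : {mfun T >-> R} := HB.pack f (isMeasurableFun.Build _ _ _ _ _ mf).
have [|y yF yz] := ss_ideal (x := z) (y := F).
  by apply: filterS2 zg fg => t ->.
by exists y; [apply: filterS yF => t /(_ Logic.I)|exact: le_trans zc].
Qed.

Lemma same_law_abs (f g : T -> R) : same_law m m f g ->
  same_law m m (fun t => `|f t|) (fun t => `|g t|).
Proof.
move=> h A mA; apply: (h (Num.norm @^-1` A)).
rewrite -[X in measurable X]setTI; exact: normr_measurable.
Qed.

Lemma same_law_eq d (S : measurableType d) (P : probability S R)
    (f g : T -> R) (h : S -> R) : measurable_fun setT f -> measurable_fun setT g ->
  {ae m, forall t, f t = g t} -> same_law m P f h -> same_law m P g h.
Proof.
move=> mf mg fg fh A mA; rewrite -(fh A mA).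
apply: ae_measure.
- by rewrite -[X in measurable X]setTI; exact: mg.
- by rewrite -[X in measurable X]setTI; exact: mf.
by apply: filterS fg => t /= ->.
Qed.

Lemma norm_le_law f g c : measurable_fun setT f -> measurable_fun setT g ->
  same_law m m g f -> norm_le g c -> norm_le f c.
Proof.
move=> mf mg gf [z zg zc].
pose F : {mfun T >-> R} := HB.pack f (isMeasurableFun.Build _ _ _ _ _ mf).
have [|y yF yz] := ss_symmetric (x := z) (y := F).
  apply: same_law_abs; apply: (@same_law_eq _ _ _ g) => //.
  by apply: filterS zg => t ->.
by exists y; [apply: filterS yF => t /(_ Logic.I)|rewrite yz].
Qed.

Lemma norm_le1 : norm_le (fun=> 1) 1.
Proof.
by have [e e1 ee] := ss_unit X; exists e; rewrite ?ee //; apply: filterS e1 => t; apply.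
Qed.

Lemma norm_le_cst (a : R) : norm_le (fun=> a) `|a|.
Proof.
rewrite -[`|a|]mulr1; apply: norm_le_eq (norm_leZ a norm_le1).
by apply: aeW => t; rewrite mulr1.
Qed.

Lemma norm_le1_ge c : norm_le (fun=> 1) c -> 1 <= c.
Proof.
have [e e1 ee] := ss_unit X => h; rewrite -ee; apply: norm_leE h.
by apply: filterS e1 => t; apply.
Qed.

Lemma norm_le_sum (I : Type) (s : seq I) (f : I -> T -> R) (c : I -> R) :
  (forall i, norm_le (f i) (c i)) ->
  norm_le (fun t => \sum_(i <- s) f i t) (\sum_(i <- s) c i).
Proof.
move=> h; elim: s => [|i s IH].
  have h0 := norm_le_cst 0; rewrite normr0 in h0.
  rewrite big_nil; apply: norm_le_eq h0.
  by apply: aeW => t; rewrite big_nil.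
rewrite big_cons; apply: norm_le_eq (norm_leD (h i) IH).
by apply: aeW => t; rewrite big_cons.
Qed.

(* The positive part of [h - z] is dominated by [u n - z]. *)
Lemma ss_fun_lim_ge (u : nat -> X) (z : X) (h : T -> R) :
  measurable_fun setT h -> u n @[n --> \oo] --> z ->
  (\forall n \near \oo, {ae m, forall t, h t <= ss_fun (u n) t}) ->
  {ae m, forall t, h t <= ss_fun z t}.
Proof.
move=> mh uz hu.
pose w t := Num.max (h t - ss_fun z t) 0.
have mw : measurable_fun setT w.
  by apply: measurable_maxr => //; apply: measurable_funB.
have wn : \forall n \near \oo, norm_le w `|u n - z|.
  apply: filterS hu => n hn; apply: norm_le_ideal (norm_le_fun (u n - z)) => //.
  apply: filterS2 hn (ss_funB (u n) z) => t hn ->.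
  rewrite ger0_norm /w; last by rewrite le_max lexx orbT.
  rewrite ge_max normr_ge0 andbT (le_trans _ (ler_norm _)) //.
  exact: lerB.
have [n0 _ hn0] := wn; have [y yw _] := hn0 n0 (leqnn _).
have y0 : y = 0.
  apply/eqP; rewrite -normr_le0; apply/ler_addgt0Pl => e e0; rewrite addr0.
  have /cvgrPdist_le /(_ _ e0) un := uz.
  near \oo => n; apply: (@le_trans _ _ `|u n - z|).
    apply: (norm_leE yw); near: n; exact: wn.
  by rewrite distrC; near: n.
rewrite y0 in yw.
apply: filterS2 yw ss_fun0 => t -> e; rewrite -subr_le0.
have : w t <= 0 by rewrite e.
by rewrite /w ge_max => /andP[].
Unshelve. all: by end_near. Qed.

End norm_le.

(** * The Kruglov operator *)

Lemma measurable_nat_index d (T : measurableType d) (R : realType) (N : T -> nat)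
    (F : nat -> T -> R) : measurable_fun setT N ->
  (forall n, measurable_fun setT (F n)) -> measurable_fun setT (fun x => F (N x) x).
Proof.
move=> mN mF _ A mA; rewrite setTI.
rewrite (_ : _ @^-1` A = \bigcup_n (N @^-1` [set n] `&` F n @^-1` A)).
  apply: bigcup_measurable => n _; apply: measurableI;
    rewrite -[X in measurable X]setTI; [exact: mN|exact: mF].
by apply/seteqP; split => x /= => [h|[n _ [/= <-]]] //; exists (N x).
Qed.

Section kruglov_operator.
Context (R : realType).
Local Notation T := (lebesgueTypeR R).
Local Notation m := (@leb01 R).

Record poisson_process (N : T -> nat) (Y : nat -> T -> T) : Prop := {
  poisson_measurable_count : measurable_fun setT N;
  poisson_measurable_point : forall k, measurable_fun setT (Y k);
  poisson_count : forall n, m (N @^-1` [set n]) = (poisson_pmf 1 n)%:E;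
  poisson_joint : forall n (A : set nat) (B : nat -> set T),
    (forall j, measurable (B j)) ->
    m (N @^-1` A `&` [set x | forall j, (j < n)%N -> B j (Y j x)]) =
    (m (N @^-1` A) * \prod_(j < n) m (B j))%E }.

Context (N : T -> nat) (Y : nat -> T -> T) (H : poisson_process N Y).
Implicit Types g h : T -> R.

Let mN := poisson_measurable_count H.
Let mY := poisson_measurable_point H.

Lemma poisson_point_law k (B : set T) : measurable B -> m (Y k @^-1` B) = m B.
Proof.
move=> mB.
have := poisson_joint H k.+1 setT
  (B := fun j => if j == k then B else setT).
rewrite preimage_setT setTI probability_setT mul1e big_ord_recr /= eqxx.
rewrite big1 ?mul1e => [<-|i _]; last by rewrite ltn_eqF // probability_setT.
  congr (m _); apply/seteqP; split => x /=; last by move=> /(_ k (leqnn _)); rewrite eqxx.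
  by move=> Bx j _; case: eqP => [->|].
by move=> j; case: eqP.
Qed.

Lemma ae_point k (P : T -> Prop) : {ae m, forall t, P t} -> {ae m, forall t, P (Y k t)}.
Proof.
case=> A [mA A0 PA]; exists (Y k @^-1` A); split.
- by rewrite -[X in measurable X]setTI; exact: mY.
- by rewrite poisson_point_law.
- by move=> t /= Pt; apply: PA.
Qed.

(** A realisation on [0, 1] of the random variable that the Kruglov property attaches to [g]. As a
    function, not just a law, it is linear and monotone in [g]. *)
Definition kruglov_op g (x : T) : R := \sum_(k < N x) g (Y k x).

Let mgY g k : measurable_fun setT g -> measurable_fun setT (g \o Y k).
Proof. by move=> mg; exact: measurableT_comp. Qed.

Lemma measurable_kruglov_op g : measurable_fun setT g ->
  measurable_fun setT (kruglov_op g).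
Proof.
move=> mg; apply: (measurable_nat_index (F := fun n x => \sum_(k < n) g (Y k x))) => // n.
by apply: measurable_sum => k; exact: mgY.
Qed.

Lemma kruglov_op_ae g h : {ae m, forall t, g t <= h t} ->
  {ae m, forall t, kruglov_op g t <= kruglov_op h t}.
Proof.
move=> gh; have : {ae m, forall t, forall k, g (Y k t) <= h (Y k t)}.
  by apply: ae_foralln => k; exact: (@ae_point k (fun t => g t <= h t)).
by apply: filterS => t ght; apply: ler_sum => k _.
Qed.

Lemma kruglov_data_points g (mg : measurable_fun setT g)
    (F : nat -> {RV m >-> R}) (N' : {RV m >-> nat}) :
  (forall k, F k = g \o Y k :> (T -> R)) -> N' = N :> (T -> nat) ->
  kruglov_data g F N'.
Proof.
move=> FE NE; split.
- move=> k A mA; rewrite FE; apply: (@poisson_point_law k (g @^-1` A)).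
  by rewrite -[X in measurable X]setTI; exact: mg.
- by move=> n; rewrite NE; exact: (poisson_count H).
apply: independent_classes_extend.
  case=> [k|]; exists setT => //; exact: preimage_setT.
move=> J uJ.
(* [J] is enlarged to the count and the first [n] points, the events for which [poisson_joint] gives
   the product formula. *)
pose n := (\max_(o <- J) if o is Some k then k.+1 else 0)%N.
exists (None :: [seq Some k | k <- iota 0 n]); split.
- rewrite /= map_inj_uniq ?iota_uniq ?andbT; last by move=> ? ? [].
  by apply/negP => /mapP[].
- case=> [k|] kJ; rewrite inE //=; apply: map_f; rewrite mem_iota /= add0n.
  by have := leq_bigmax_seq (P := predT)
    (F := fun o => if o is Some k then k.+1 else 0%N) _ kJ isT.
move=> E CE.
have hB k : exists B : set T, measurable B /\ Y k @^-1` B = E (Some k).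
  have [A mA <-] := CE (Some k); exists (g @^-1` A); split.
    by rewrite -[X in measurable X]setTI; exact: mg.
  by rewrite FE.
have [B hB'] := choice hB.
have [A _ AE] := CE None; rewrite NE in AE.
rewrite big_cons big_map -AE -[in RHS](subn0 n) -/(index_iota 0 n) big_mkord.
rewrite (eq_bigr (fun k : 'I_n => m (B k))) => [|k _]; last first.
  by rewrite -(hB' k).2; exact/poisson_point_law/(hB' k).1.
rewrite -[RHS](poisson_joint H) => [|j]; last exact: (hB' j).1.
congr (m _); apply/seteqP; split => x /=.
  move=> h; split; first by have := h None (mem_head _ _); rewrite -AE.
  move=> j jn; have := h (Some j); rewrite -(hB' j).2; apply.
  by rewrite /= inE map_f // mem_iota.
case=> h0 h [k|] /=; last by rewrite -AE.
rewrite inE /= => /mapP[j]; rewrite mem_iota /= add0n => jn [->].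
by rewrite -(hB' j).2; exact: h.
Qed.

(** * Boundedness of the Kruglov operator on the nonnegative cone *)

Section boundedness.
Context (X : symmetric_space R) (hK : kruglov_property X).

Lemma kruglov_op_mem (z : X) : exists c, norm_le X (kruglov_op (ss_fun z)) c.
Proof.
have mz : measurable_fun setT (ss_fun z) by exact: measurable_funPT.
pose F k : {RV m >-> R} :=
  HB.pack (ss_fun z \o Y k) (isMeasurableFun.Build _ _ _ _ _ (mgY k mz)).
pose N' : {RV m >-> nat} := HB.pack N (isMeasurableFun.Build _ _ _ _ _ mN).
have [y hy] := hK (kruglov_data_points mz (F := F) (N' := N') (fun=> erefl) erefl).
exists `|y|; apply: norm_le_law (norm_le_fun y) => //.
exact: measurable_kruglov_op.
Qed.

(** If no constant works, unit-bounded [g n] violate the bounds [4 ^ n]. The sum [w] of the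
    [2 ^ -n * g n] lies in [X] by completeness, and its image has some bound [c]. Since [w]
    dominates each term, the image of [g n] is bounded by [2 ^ n * c], which is at most [4 ^ n] for
    a suitable [n]. *)
Lemma kruglov_op_bounded : exists2 C : R, 0 < C & forall g,
  measurable_fun setT g -> (forall t, 0 <= g t) -> norm_le X g 1 ->
  norm_le X (kruglov_op g) C.
Proof.
apply: contrapT => nC.
have hg n : exists g, [/\ measurable_fun setT g, forall t, 0 <= g t,
    norm_le X g 1 & ~ norm_le X (kruglov_op g) (4 ^+ n)].
  apply: contrapT => h; apply: nC; exists (4 ^+ n); first exact: exprn_gt0.
  by move=> g mg g0 g1; apply: contrapT => g4; apply: h; exists g.
have [g hg'] := choice hg.
have mg n : measurable_fun setT (g n) by have [] := hg' n.
have g0 n t : 0 <= g n t by have [] := hg' n.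
have hz n : exists z : X, {ae m, forall t, ss_fun z t = g n t} /\ `|z| <= 1.
  by have [_ _ [z ? ?] _] := hg' n; exists z.
have [z hz'] := choice hz.
pose u n := (2^-1 ^+ n : R) *: z n.
have half0 : 0 <= 2^-1 :> R by rewrite invr_ge0.
have cu : cvgn (series u).
  apply: normed_cvg; apply: (series_le_cvg (v_ := geometric 1 2^-1)).
  - by move=> n /=.
  - by move=> n; rewrite /geometric /= mul1r exprn_ge0.
  - move=> n; rewrite /geometric /= mul1r /u normrZ ger0_norm ?exprn_ge0 //.
    by rewrite ler_piMr ?exprn_ge0 //; exact: (hz' n).2.
  - apply: is_cvg_geometric_series.
    by rewrite ger0_norm // invf_lt1 // ltr1n.
pose w : X := limn (series u).
(* The series converges in norm, not pointwise; the domination by partial sums passes to the limit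
   through the lattice structure. *)
have hw n : {ae m, forall t, 2^-1 ^+ n * g n t <= ss_fun w t}.
  apply: (ss_fun_lim_ge (u := series u)) => //.
    exact: measurable_funM.
  exists n.+1 => // k /= nk; rewrite /series /=.
  have h1 := ss_fun_sum (index_iota 0 k) (fun n => 2^-1 ^+ n) z.
  have h2 : {ae m, forall t, forall n, ss_fun (z n) t = g n t}.
    by apply: ae_foralln => j; exact: (hz' j).1.
  apply: filterS2 h1 h2 => t -> h2.
  rewrite (bigD1_seq n) ?mem_index_iota ?iota_uniq //= h2 lerDl.
  by apply: sumr_ge0 => j _; rewrite h2 mulr_ge0 // exprn_ge0.
have [c hc] := kruglov_op_mem w.
have c0 := norm_le_ge0 hc.
(* This index gives [c < n + 1 <= 2 ^ n]. *)
pose n := Num.truncn c.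
have [_ _ _] := hg' n; apply.
have le1 : norm_le X (fun t => 2^-1 ^+ n * kruglov_op (g n) t) c.
  apply: norm_le_ideal hc.
    by apply: measurable_funM => //; exact: measurable_kruglov_op.
  apply: filterS (kruglov_op_ae (hw n)) => t h.
  rewrite ger0_norm; last first.
    by rewrite mulr_ge0 ?exprn_ge0 // sumr_ge0.
  by rewrite (le_trans _ (ler_norm _)) // (le_trans _ h) // /kruglov_op mulr_sumr.
have := norm_leZ (2 ^+ n) le1.
rewrite ger0_norm ?exprn_ge0 // => h.
apply: (@norm_le_trans _ _ _ (2 ^+ n * c)); last first.
  apply: norm_le_eq h; apply: aeW => t.
  by rewrite mulrA -exprMn mulfV ?pnatr_eq0 // expr1n mul1r.
rewrite (_ : 4 = 2 * 2) ?exprMn; last by rewrite -natrM.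
rewrite ler_wpM2l ?exprn_ge0 // (le_trans (ltW (truncnS_gt c))) //.
by rewrite -natrX ler_nat -/n ltn_expl.
Qed.

End boundedness.
End kruglov_operator.

(** * The mean is bounded by the norm *)

(** The indices at which an antitone [b] holds form an initial segment. Counts of nested sets are
    thereby reduced to a single membership. *)
Lemma antitone_count (b : nat -> bool) (M j : nat) :
  (forall i i', (i <= i')%N -> b i' -> b i) ->
  (j < \sum_(i < M) b i)%N = (j < M)%N && b j.
Proof.
move=> anti; elim: M => [|M IH]; first by rewrite big_ord0.
rewrite big_ord_recr /=; case: (boolP (b M)) => bM.
  have -> : (\sum_(i < M) b i = M)%N.
    rewrite (eq_bigr (fun=> 1%N)) ?sum1_card ?card_ord // => i _.
    by rewrite (anti i M) // ltnW.
  rewrite addn1; case: leqP => //= jM.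
  by rewrite (anti j M).
rewrite addn0 IH ltnS [in RHS]leq_eqVlt; case: eqP => [->|] //=.
by rewrite ltnn (negbTE bM).
Qed.

Section mean.
Context (R : realType) (X : symmetric_space R).
Local Notation T := (lebesgueTypeR R).
Local Notation m := (@leb01 R).

Lemma ae_co01 : {ae m, forall t : T, 0 <= (t : R) < 1}.
Proof.
have mI := @measurable_co01 R.
exists (~` `[0, 1[%classic); split; first exact: measurableC.
  rewrite probability_setC // [X in (_ - X)%E](_ : _ = 1%E) ?subee //.
  by have /= := @leb01_itv R 0 1 (lexx 0) ler01 (lexx 1); rewrite subr0.
by move=> x /= h; rewrite in_itv.
Qed.

Definition step (p : nat) (c : nat -> R) (x : T) : R :=
  if 0 <= (x : R) < 1 then c (Num.truncn (p%:R * x)) else 0.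

Lemma step_preimage p c (A : set R) :
  step p c @^-1` A `&` `[0, 1[%classic = cell p (fun k => c k \in A).
Proof.
apply/seteqP; split => x /=; rewrite in_itv /= /step.
  by case=> + x01; rewrite x01 => h; split => //; rewrite in_setE.
by case=> x01; rewrite x01 in_setE.
Qed.

Lemma measurable_step p c : (0 < p)%N -> measurable_fun setT (step p c).
Proof.
move=> p0 _ A mA; rewrite setTI.
have mI := @measurable_co01 R.
rewrite (_ : _ @^-1` A = (step p c @^-1` A `&` `[0, 1[%classic) `|`
    (if 0 \in A then ~` `[0, 1[%classic else set0)).
  apply: measurableU; first by rewrite step_preimage; exact: measurable_cell.
  by case: ifP => _; [exact: measurableC|exact: measurable0].
apply/seteqP; split => x /=.
  rewrite in_itv /= /step; case: ifPn => x01 Ax; first by left.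
  by right; rewrite mem_set //= in_itv /=; exact/negP.
case=> [[]//|]; case: ifPn => // A0 /=; rewrite in_itv /= /step => /negP/negbTE ->.
by rewrite -in_setE.
Qed.

Lemma leb01_step p c (A : set R) : (0 < p)%N -> measurable A ->
  m (step p c @^-1` A) = ((\sum_(k < p) (c k \in A)%:R) / p%:R)%:E.
Proof.
move=> p0 mA; rewrite leb01_setI_co.
  by rewrite step_preimage leb01_cell.
by rewrite -[X in measurable X]setTI; exact: measurable_step.
Qed.

Lemma sum_shift (V : nmodType) p (s : nat) (F : nat -> V) :
  \sum_(k < p.+1) F ((k + s) %% p.+1)%N = \sum_(k < p.+1) F k.
Proof.
rewrite [RHS](reindex_inj (addIr (inZp s : 'I_p.+1))) /=.
by apply: eq_bigr => k _; rewrite modnDmr.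
Qed.

(* The cyclic shifts of the cells average to a constant. *)
Lemma step_mean_le p c C : norm_le X (step p.+1 c) C -> (forall k, 0 <= c k) ->
  \sum_(k < p.+1) c k <= p.+1%:R * C.
Proof.
move=> hc c0; set S := \sum_(_ < _) _.
have C0 := norm_le_ge0 hc.
have [S0|] := leP S 0; first by rewrite (le_trans S0) // mulr_ge0.
move=> S0.
pose h (s : 'I_p.+1) := step p.+1 (fun k => c ((k + s) %% p.+1)%N).
have hs s : norm_le X (h s) C.
  apply: norm_le_law hc; [exact: measurable_step..|].
  move=> A mA.
  transitivity ((\sum_(k < p.+1) (c k \in A)%:R) / p.+1%:R : R)%:E.
    exact: leb01_step.
  rewrite -(@sum_shift _ p s (fun k => (c k \in A)%:R : R)).
  by apply/esym; exact: leb01_step.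
have hS : norm_le X (fun=> S) (p.+1%:R * C).
  have := @norm_le_sum R X _ (index_enum 'I_p.+1) h (fun=> C) hs.
  rewrite sumr_const card_ord -[C *+ _]mulr_natl => hS; apply: norm_le_eq hS.
  apply: filterS ae_co01 => t t01; rewrite /h /step t01.
  rewrite (eq_bigr (fun s : 'I_p.+1 =>
    c ((s + Num.truncn (p.+1%:R * t)) %% p.+1)%N)).
    exact: (@sum_shift _ p).
  by move=> s _; rewrite addnC.
have h1 := norm_leZ S^-1 hS.
have Sinv : 0 <= S^-1 by rewrite invr_ge0 ltW.
rewrite ger0_norm // in h1.
have : 1 <= S^-1 * (p.+1%:R * C).
  apply: (@norm_le1_ge _ X); apply: norm_le_eq h1.
  by apply: aeW => t; rewrite mulVf // gt_eqF.
by rewrite mulrC ler_pdivlMr // mul1r.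
Qed.

Section layers.
Context (g : T -> R) (mg : measurable_fun setT g) (g0 : forall t, 0 <= g t).
Context (C : R) (gC : norm_le X g C) (d : R) (d0 : 0 < d).

Let A (i : nat) : set T := g @^-1` `]i.+1%:R * d, +oo[.
Let a i : R := fine (m (A i)).

Let mA i : measurable (A i).
Proof. by rewrite -[X in measurable X]setTI; exact: mg. Qed.

Let aE i : (a i)%:E = m (A i).
Proof. by rewrite fineK // fin_num_measure. Qed.

Let a01 i : 0 <= a i <= 1.
Proof. by rewrite -!lee_fin aE measure_ge0 probability_le1. Qed.

(** Within [0, 1] this is an initial interval with the measure of [A i]: a decreasing rearrangement
    of the level sets, comparable with equal cells. *)
Let B (i : nat) : set T := [set x : R | x < a i].

Let mB i : measurable (B i).
Proof.
have -> : B i = `]-oo, a i[%classic by apply/seteqP; split => x; rewrite /= in_itv.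
by apply: borel_lebesgue; exact: measurable_itv.
Qed.

Let mBA i : m (B i) = m (A i).
Proof.
have /andP[a_ge0 a_le1] := a01 i.
rewrite leb01_setI_co // (_ : _ `&` _ = `[0, a i[%classic).
  by rewrite leb01_itv // subr0 aE.
apply/seteqP; split => x /=; rewrite !in_itv /=.
  by case=> -> /andP[-> _].
by case/andP=> x0 xa; rewrite x0 (lt_le_trans xa a_le1).
Qed.

(** For [D = A] this is a lower approximation of [g] by multiples of [d], cut off at [M * d]. *)
Let layer (D : nat -> set T) (M : nat) (x : T) : R :=
  d * (\sum_(i < M) (x \in D i))%:R.

Let nested (D : nat -> set T) := forall i i', (i <= i')%N -> D i' `<=` D i.

Let nA : nested A.
Proof.
move=> i i' ii' x; rewrite /A /= !in_itv /= !andbT; apply: le_lt_trans.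
by rewrite ler_pM2r // ler_nat ltnS.
Qed.

Let nB : nested B.
Proof.
move=> i i' ii' x; rewrite /B /= => /lt_le_trans; apply.
by rewrite -lee_fin !aE; apply: le_measure; rewrite ?inE //; exact: nA.
Qed.

(** By nestedness a ray pulls back to a single layer, so the law of the function depends only on the
    measures of the [D i]. Hence the versions built on [A] and on [B] are identically
    distributed. *)
Let layer_ray D M s : nested D -> layer D M @^-1` `]s, +oo[ =
  if s < 0 then setT else
  let j := Num.truncn (s / d) in if (j < M)%N then D j else set0.
Proof.
move=> nD; apply/seteqP; split => x.
  rewrite /= in_itv /= andbT /layer; case: ifPn => // s0.
  rewrite -leNgt in s0; rewrite mulrC -ltr_pdivrMr // => h.
  have : (Num.truncn (s / d) < \sum_(i < M) (x \in D i))%N.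
    by rewrite truncn_lt_nat // divr_ge0 // ltW.
  rewrite (antitone_count (b := fun i => x \in D i)).
    by case/andP=> ->; rewrite in_setE.
  by move=> i i' ii'; rewrite !in_setE; exact: nD.
rewrite /= in_itv /= andbT /layer; case: ifPn => [s0 _|s0].
  by rewrite (lt_le_trans s0) // mulr_ge0 // ltW.
rewrite -leNgt in s0; case: ifPn => // jM Dj.
have sd : 0 <= s / d by rewrite divr_ge0 // ltW.
rewrite mulrC -ltr_pdivrMr // -truncn_lt_nat //.
rewrite (antitone_count (b := fun i => x \in D i)).
  by rewrite jM in_setE.
by move=> i i' ii'; rewrite !in_setE; exact: nD.
Qed.

Let measurable_layer D M : nested D -> (forall i, measurable (D i)) ->
  measurable_fun setT (layer D M).
Proof.
move=> nD mD; apply: (measurability _ (RGenOInfty.measurableE R)) => //.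
move=> _ [_ [t ->] <-]; rewrite setTI layer_ray //=.
by case: ifP => // _; case: ifP.
Qed.

Let layer_le M t : layer A M t <= g t.
Proof.
rewrite /layer; set n := (\sum_(_ < _) _)%N.
have [->|] := posnP n; first by rewrite mulr0.
move=> n0; have : (n.-1 < n)%N by rewrite prednK.
rewrite {2}/n (antitone_count _ _ (b := fun i => t \in A i)).
  case/andP=> _; rewrite in_setE /A /= in_itv /= andbT prednK // => h.
  by rewrite mulrC ltW.
by move=> i i' ii'; rewrite !in_setE; exact: nA.
Qed.

Lemma layers_sum_le M : d * \sum_(i < M) a i <= C.
Proof.
have hA : norm_le X (layer A M) C.
  apply: norm_le_ideal gC; first exact: measurable_layer.
  apply: aeW => t; have l0 : 0 <= layer A M t by rewrite mulr_ge0 // ltW.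
  by rewrite (ger0_norm (g0 t)) (ger0_norm l0).
have hB : norm_le X (layer B M) C.
  apply: norm_le_law hA; [exact: measurable_layer..|].
  apply: ray_unique; [exact: measurable_layer..|] => t.
  by rewrite !layer_ray //=; case: ifP => // _; case: ifP => // _; rewrite mBA.
apply/ler_addgt0Pl => e e0.
(* With [p + 1] cells, rounding each of the [M] intervals to whole cells costs at most
   [d * M / (p + 1) < e] in total. *)
pose p := Num.truncn (d * M%:R / e).
(* The interval [B i] is counted on cell [k] only when it contains the whole cell, so the step
   function stays below the layers. *)
pose c (k : nat) := d * (\sum_(i < M) (k.+1%:R <= p.+1%:R * a i)%R)%:R.
have hc : norm_le X (step p.+1 c) C.
  apply: norm_le_ideal hB; first exact: measurable_step.
  apply: filterS ae_co01 => t t01; rewrite /step t01 !ger0_norm ?mulr_ge0 ?(ltW d0) //.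
  rewrite ler_pM2l // ler_nat; apply: leq_sum => i _.
  case: (boolP (_ <= _ :> R)) => // h; rewrite mem_set //.
  rewrite /B /= -(ltr_pM2l (_ : 0 < p.+1%:R)) ?ltr0n //.
  by rewrite (lt_le_trans _ h) // truncnS_gt.
have c0 k : 0 <= c k by rewrite mulr_ge0 // ltW.
have := step_mean_le hc c0.
have count_ge i : p.+1%:R * a i - 1 <=
    (\sum_(k < p.+1) (k.+1%:R <= p.+1%:R * a i)%R)%:R.
  set n := (\sum_(_ < _) _)%N; rewrite lerBlDr.
  have := ltnn n; rewrite {2}/n.
  rewrite (antitone_count (b := fun k => k.+1%:R <= p.+1%:R * a i)).
    move/negbT; rewrite negb_and -leqNgt -ltNge => /orP[pn|].
      apply: (@le_trans _ _ p.+1%:R); last by rewrite ler_wpDr // ler_nat.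
      by rewrite ler_piMr //; case/andP: (a01 i).
    by move=> /ltW; rewrite -[X in _ <= X]natr1.
  by move=> k k' kk'; apply: le_trans; rewrite ler_nat ltnS.
have -> : \sum_(k < p.+1) c k =
    d * \sum_(i < M) (\sum_(k < p.+1) (k.+1%:R <= p.+1%:R * a i)%R)%:R.
  rewrite -mulr_sumr; congr (_ * _).
  under eq_bigr do rewrite natr_sum.
  by rewrite exchange_big /=; apply: eq_bigr => i _; rewrite natr_sum.
move=> h.
have : d * \sum_(i < M) (p.+1%:R * a i - 1) <= p.+1%:R * C.
  apply: le_trans h; rewrite ler_pM2l //; apply: ler_sum => i _; exact: count_ge.
rewrite sumrB sumr_const card_ord -mulr_sumr => h1.
have h2 : d * M%:R < p.+1%:R * e.
  by rewrite -ltr_pdivrMr // truncnS_gt.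
have p0 : 0 < p.+1%:R :> R by rewrite ltr0n.
rewrite -(ler_pM2l p0); move: h1 h2; set s := \sum_(_ < _) _; set q : R := p.+1%:R.
set M' : R := M%:R; nra.
Qed.

Lemma layers_mean_le : (\int[m]_t (g t)%:E <= (C + 2 * d)%:E)%E.
Proof.
pose S t : \bar R := (\sum_(i <oo) (d * \1_(A i) t)%:E)%E.
have h0 i t : (0 <= (d * \1_(A i) t)%:E)%E.
  by rewrite lee_fin mulr_ge0 // ltW.
have S0 t : (0 <= S t)%E by apply: nneseries_ge0.
(* One [d] pays for rounding [g t] down to a multiple of [d], the other for the strict inequality in
   [A], which may miss the last layer. *)
have g_le t : ((g t)%:E <= (2 * d)%:E + S t)%E.
  pose n := Num.truncn (g t / d).
  have hn : (\sum_(0 <= i < n.-1) (d * \1_(A i) t)%:E <= S t)%E.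
    by apply: nneseries_lim_ge => *; exact: h0.
  apply: (le_trans _ (leeD2l _ hn)); rewrite sumEFin -EFinD lee_fin.
  have gn : g t < n.+1%:R * d by rewrite -ltr_pdivrMr // truncnS_gt.
  have nd : n%:R * d <= g t by rewrite -ler_pdivlMr // truncn_le divr_ge0 // ltW.
  rewrite (eq_big_nat _ _ (F2 := fun=> d)) => [|i /= i_n]; last first.
    rewrite indicE mem_set ?mulr1 // /A /= in_itv /= andbT.
    by apply: lt_le_trans nd; rewrite ltr_pM2r // ltr_nat; lia.
  rewrite sumr_const_nat subn0 -[d *+ _]mulr_natl (le_trans (ltW gn)) // -mulrDl ler_pM2r //.
  by rewrite -natrD ler_nat; lia.
have mI i : measurable_fun setT (fun t => (d * \1_(A i) t)%:E).
  by apply/measurable_EFinP; apply: measurable_funM => //; exact: measurable_indic.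
have mS : measurable_fun setT S.
  by apply: (ge0_emeasurable_sum (P := xpredT)) => *; [exact: h0|exact: mI].
have d2 : 0 <= 2 * d by rewrite mulr_ge0 // ltW.
apply: (@le_trans _ _ (\int[m]_t ((2 * d)%:E + S t))%E).
  apply: ge0_le_integral => //.
  - by move=> t _; rewrite lee_fin.
  - exact/measurable_EFinP.
  - exact: emeasurable_funD.
rewrite ge0_integralD //.
have -> : (\int[m]_t (2 * d)%:E = (2 * d)%:E)%E.
  by rewrite integral_cst //= leb01_setT mule1.
rewrite [C + _]addrC EFinD; apply: leeD2l.
rewrite integral_nneseries //.
apply: lime_le; first by apply: is_cvg_nneseries => *; apply: integral_ge0 => *; exact: h0.
apply: nearW => M.
rewrite (eq_bigr (fun i => (d * a i)%:E)) => [|i _].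
  by rewrite sumEFin -mulr_sumr big_mkord lee_fin; exact: layers_sum_le.
under eq_integral do rewrite EFinM.
rewrite ge0_integralZl_EFin ?(ltW d0) //; last first.
  by apply/measurable_EFinP; exact: measurable_indic.
by rewrite integral_indic // setIT EFinM aE.
Qed.

End layers.

(** It makes the maxima integrable and controls the centring terms, including those of whole linear
    combinations. *)
Lemma mean_le_norm (g : T -> R) C : measurable_fun setT g -> (forall t, 0 <= g t) ->
  norm_le X g C -> (\int[m]_t (g t)%:E <= C%:E)%E.
Proof.
move=> mg g0 gC; apply/lee_addgt0Pr => e e0.
have e2 : 0 < e / 2 by rewrite divr_gt0.
have := layers_mean_le mg g0 gC e2.
by rewrite mulrC divfK ?pnatr_eq0.
Qed.

End mean.

(** * Void probabilities and Poisson maxima *)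

Section void_probability.
Context (R : realType).
Local Notation T := (lebesgueTypeR R).
Local Notation m := (@leb01 R).
Context (N : T -> nat) (Y : nat -> T -> T) (H : poisson_process N Y).

Let mN := poisson_measurable_count H.
Let mY := poisson_measurable_point H.

Definition void (B : set T) : set T := [set x | forall j, (j < N x)%N -> ~ B (Y j x)].

Lemma measurable_count n : measurable (N @^-1` [set n]).
Proof. by rewrite -[X in measurable X]setTI; exact: mN. Qed.

Let voidE B : void B = \bigcup_n (N @^-1` [set n] `&`
  [set x | forall j, (j < n)%N -> (~` B) (Y j x)]).
Proof.
apply/seteqP; split => x /= => [h|[n _ [/= <-]] //].
by exists (N x).
Qed.

Let measurable_void_level B n : measurable B ->
  measurable (N @^-1` [set n] `&` [set x | forall j, (j < n)%N -> (~` B) (Y j x)]).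
Proof.
move=> mB; apply: measurableI; first exact: measurable_count.
rewrite (_ : mkset _ = \bigcap_(j in `I_n) Y j @^-1` (~` B)).
  apply: bigcap_measurableType => j _; rewrite -[X in measurable X]setTI.
  by apply: mY => //; exact: measurableC.
by apply/seteqP; split => x h j /= /h.
Qed.

Lemma sum_poisson_pmf_expn (b : R) : 0 <= b ->
  (\sum_(n <oo) (poisson_pmf 1 n * b ^+ n)%:E = (expR (b - 1))%:E)%E.
Proof.
move=> b0.
rewrite [RHS](_ : _ = (expR (- 1))%:E * (expR b)%:E)%E; last first.
  by rewrite -EFinM -expRD addrC.
rewrite (eq_eseriesr (g := fun n => ((expR (- 1))%:E * (b ^+ n / n`!%:R)%:E)%E)).
  rewrite nneseriesZl/=; last first.
    by move=> n _; rewrite lee_fin divr_ge0// exprn_ge0.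
  congr *%E; rewrite expRE -EFin_lim; last first.
    rewrite /pseries/=; under eq_fun do rewrite mulrC.
    exact: is_cvg_series_exp_coeff.
  apply/congr_lim/funext => n/=; rewrite /pseries/= /series/= -sumEFin//.
  by under eq_bigr do rewrite mulrC.
move=> n _; rewrite -EFinM /poisson_pmf ltr01 expr1n mul1r; congr _%:E.
by rewrite mulrAC mulrC; congr (_ * _); exact: mulrC.
Qed.

(** Given [n] points, all of them miss [B] with probability [(1 - b) ^ n], where [b] is the measure
    of [B]; the generating function of the Poisson law sums these to [exp (- b)]. *)
Lemma leb01_void B : measurable B -> m (void B) = (expR (- fine (m B)))%:E.
Proof.
move=> mB; rewrite voidE measure_bigcup; last 2 first.
- by move=> n _; exact: measurable_void_level.
- by move=> i j _ _ [x [[/= <- _] [/= <- _]]].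
set b := fine (m B).
have b01 : 0 <= b <= 1.
  by rewrite -!lee_fin fineK ?fin_num_measure // measure_ge0 probability_le1.
have -> : - b = (1 - b) - 1 by ring.
rewrite -sum_poisson_pmf_expn; last by rewrite subr_ge0; case/andP: b01.
rewrite (eq_eseriesl (Q := xpredT)); last by move=> n; rewrite in_setT.
apply: eq_eseriesr => n _.
transitivity (m (N @^-1` [set n]) * \prod_(j < n) m (~` B))%E.
  apply: (poisson_joint H n [set n] (B := fun=> ~` B)) => j.
  exact: measurableC.
rewrite (poisson_count H) EFinM; congr (_ * _)%E.
rewrite (eq_bigr (fun=> (1 - b)%:E)) => [|j _].
  by rewrite prodEFin prodr_const card_ord.
by rewrite EFinB fineK ?fin_num_measure //; exact: probability_setC.
Qed.

(** Missing every [B i] means missing their union. The measure is additive on sets with null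
    overlaps, and the exponential turns the sum into a product. *)
Lemma leb01_bigcap_void (I : choiceType) (J : seq I) (B : I -> set T) : uniq J ->
  (forall i, measurable (B i)) -> (forall i j, i != j -> m (B i `&` B j) = 0%E) ->
  m (\bigcap_(i in [set` J]) void (B i)) = (\prod_(i <- J) m (void (B i)))%E.
Proof.
move=> uJ mB B0.
pose U (J : seq I) := \big[setU/set0]_(i <- J) B i.
have mU (J' : seq I) : measurable (U J') by apply: bigsetU_measurable.
have -> : \bigcap_(i in [set` J]) void (B i) = void (U J).
  apply/seteqP; split => x h.
    move=> j jN; rewrite /U -bigcup_seq => -[i iJ /= Bi]; exact: (h i iJ j).
  move=> i iJ j jN Bi; apply: (h j jN); rewrite /U -bigcup_seq; by exists i.
rewrite leb01_void // (eq_bigr (fun i => (expR (- fine (m (B i))))%:E)); last first.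
  by move=> i _; rewrite leb01_void.
rewrite prodEFin; congr _%:E.
rewrite -expR_sum sumrN; congr (expR (- _)).
elim: J uJ => [|i J IH] /=; first by rewrite /U !big_nil measure0.
case/andP=> iJ uJ; rewrite [in RHS]big_cons -IH // {1}/U big_cons -/(U J).
have i0 : m (B i `&` U J) = 0%E.
  rewrite /U -bigcup_seq setI_bigcupr.
  apply/eqP; rewrite eq_le measure_ge0 andbT.
  have mm k : measurable (B i `&` B k) by exact: measurableI.
  have -> : \bigcup_(k in [set` J]) (B i `&` B k) = \big[setU/set0]_(k <- J) (B i `&` B k).
    by rewrite bigcup_seq.
  elim: {IH} J iJ {uJ} => [|k J IH]; first by rewrite big_nil measure0.
  rewrite inE negb_or => /andP[ik iJ]; rewrite big_cons.
  have mU' : measurable (\big[setU/set0]_(k <- J) (B i `&` B k)).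
    exact: bigsetU_measurable.
  apply: (le_trans (measureU2 _ (mm k) mU')).
  rewrite -[leRHS]adde0; apply: leeD; last exact: IH.
  by have /= -> := B0 _ _ ik.
rewrite measureUfinr //; last by rewrite -ge0_fin_numE // fin_num_measure.
rewrite [X in (_ - X)%E](_ : _ = 0%E); last exact: i0.
by rewrite sube0 fineD // fin_num_measure.
Qed.

End void_probability.

Lemma independent_functions_comp d (T : measurableType d) (R : realType)
    (P : probability T R) (I : eqType) (f : I -> T -> R) (phi : I -> R -> R) :
  (forall i, measurable_fun setT (phi i)) -> independent_functions P f ->
  independent_functions P (fun i t => phi i (f i t)).
Proof.
move=> mphi indf J E uJ hE; apply: indf => // i /hE[A mA <-].
exists (phi i @^-1` A) => //.
by rewrite -[X in measurable X]setTI; exact: mphi.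
Qed.

Lemma ae_forall_ord d (T : measurableType d) (R : realType)
    (mu : {measure set T -> \bar R}) n (Q : 'I_n -> T -> Prop) :
  (forall i, {ae mu, forall t, Q i t}) -> {ae mu, forall t, forall i, Q i t}.
Proof.
move=> h.
have : {ae mu, forall t, forall k, forall i : 'I_n, i = k :> nat -> Q i t}.
  apply: ae_foralln => k; have [kn|nk] := ltnP k n.
    apply: filterS (h (Ordinal kn)) => t Qt i ik.
    by rewrite (_ : i = Ordinal kn) //; exact: val_inj.
  by apply: aeW => t i ik; move: (ltn_ord i); rewrite ik ltnNge nk.
by apply: filterS => t ht i; exact: (ht i i).
Qed.

(** Elements of [X] determine their functions only almost everywhere, whereas independence is first
    shown for explicit maxima. *)
Lemma independent_functions_ae d (T : measurableType d) (R : realType)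
    (P : probability T R) n (f g : 'I_n -> T -> R) :
  (forall i, measurable_fun setT (f i)) -> (forall i, measurable_fun setT (g i)) ->
  (forall i, {ae P, forall t, f i t = g i t}) ->
  independent_functions P f -> independent_functions P g.
Proof.
move=> mf mg fg indf J E uJ hE.
have hA i : exists A : set R, measurable A /\ (i \in J -> g i @^-1` A = E i).
  case: (boolP (i \in J)) => [/hE[A mA AE]|_]; first by exists A.
  by exists set0.
have [A hA'] := choice hA.
have fgA i : P (f i @^-1` A i) = P (g i @^-1` A i).
  have mA := (hA' i).1.
  apply: ae_measure.
  - by rewrite -[X in measurable X]setTI; exact: mf.
  - by rewrite -[X in measurable X]setTI; exact: mg.
  - by apply: filterS (fg i) => t /= ->.
transitivity (P (\bigcap_(i in [set` J]) f i @^-1` A i)).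
  apply: ae_measure.
  - apply: bigcap_seq_measurable => i iJ; rewrite -(hA' i).2 //.
    by rewrite -[X in measurable X]setTI; apply: mg => //; exact: (hA' i).1.
  - apply: bigcap_seq_measurable => i iJ.
    by rewrite -[X in measurable X]setTI; apply: mf => //; exact: (hA' i).1.
  - apply: filterS (ae_forall_ord fg) => t ht; split => h i iJ.
      by have := h i iJ; rewrite -(hA' i).2 //= ht.
    by rewrite -(hA' i).2 //= -ht; exact: h.
rewrite (indf J (fun i => f i @^-1` A i)) //.
  by apply: eq_big_seq => i iJ; rewrite fgA (hA' i).2.
by move=> i _; exists (A i) => //; exact: (hA' i).1.
Qed.

Section poisson_max.
Context (R : realType).
Local Notation T := (lebesgueTypeR R).
Local Notation m := (@leb01 R).
Context (N : T -> nat) (Y : nat -> T -> T) (H : poisson_process N Y).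

Let mN := poisson_measurable_count H.
Let mY := poisson_measurable_point H.

(** The value 0 in the absence of points is what makes the centring harmless in
    [poisson_max_lower]. *)
Definition poisson_max (g : T -> R) (x : T) : R := \big[Num.max/0]_(j < N x) g (Y j x).

Lemma measurable_poisson_max g : measurable_fun setT g ->
  measurable_fun setT (poisson_max g).
Proof.
move=> mg.
suff h n (F : nat -> T -> R) : (forall j, measurable_fun setT (F j)) ->
    measurable_fun setT (fun x => \big[Num.max/0]_(j < n) F j x).
  apply: (measurable_nat_index
    (F := fun n x => \big[Num.max/0]_(j < n) g (Y j x))) => // n.
  by apply: (h n (fun j => g \o Y j)) => j; exact: measurableT_comp.
elim: n F => [|n IH] F mF.
  rewrite (_ : (fun _ => _) = cst 0); first exact: measurable_cst.
  by apply/funext => x; rewrite big_ord0.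
rewrite (_ : (fun _ => _) =
    (fun x => Num.max (F 0%N x) (\big[Num.max/0]_(j < n) F j.+1 x))).
  by apply: measurable_maxr => //; exact: (IH (fun j => F j.+1)).
by apply/funext => x; rewrite big_ord_recl.
Qed.

Lemma poisson_max_ge0 g x : 0 <= poisson_max g x.
Proof. exact: bigmax_ge_id. Qed.

Lemma poisson_max_le g x : (forall t, 0 <= g t) ->
  poisson_max g x <= kruglov_op N Y g x.
Proof.
move=> g0; apply/bigmax_leP; split; first exact: sumr_ge0.
by move=> j _; rewrite /kruglov_op (bigD1 j) //= lerDl; exact: sumr_ge0.
Qed.

Lemma poisson_max_ge g x j : (j < N x)%N -> g (Y j x) <= poisson_max g x.
Proof. by move=> jN; apply: (@le_bigmax _ _ _ _ _ (Ordinal jN)). Qed.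

Lemma poisson_max_lt g (s : R) : 0 < s ->
  [set x | poisson_max g x < s] = void N Y [set t | s <= g t].
Proof.
move=> s0; apply/seteqP; split => x /=.
  by move=> h j jN /= sg; have := le_lt_trans (le_trans sg (poisson_max_ge g jN)) h;
    rewrite ltxx.
move=> h; apply/bigmax_ltP; split => // j _.
by rewrite ltNge; apply/negP => sg; exact: (h j).
Qed.

Lemma poisson_max_independent n (g : 'I_n -> T -> R) :
  (forall i, measurable_fun setT (g i)) ->
  (forall i j, i != j -> {ae m, forall t, g i t = 0 \/ g j t = 0}) ->
  independent_functions m (fun i => poisson_max (g i)).
Proof.
move=> mg g0.
(* The sign change turns right rays into events of the form [poisson_max < s], which are void events
   when [s > 0]. *)
suff : independent_functions m (fun i x => - poisson_max (g i) x).
  move/(@independent_functions_comp _ _ _ _ _ _ (fun=> -%R)) => h.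
  have {}h : independent_functions m (fun i x => - - poisson_max (g i) x).
    by apply: h => i; exact: oppr_measurable.
  by move: h; under eq_fun do under eq_fun do rewrite opprK.
apply: rays_independent => [i|J t uJ].
  by apply: measurable_funN; exact: measurable_poisson_max.
have rayE i : (fun x => - poisson_max (g i) x) @^-1` `]t i, +oo[ =
    [set x | poisson_max (g i) x < - t i].
  by apply/seteqP; split => x /=; rewrite in_itv /= andbT ltrNr.
have [t0|] := boolP (all (fun i => t i < 0) J).
  (* The empty default keeps the sets almost disjoint also for indices outside [J], where [t i] may
     be nonnegative. *)
  pose B i : set T := if t i < 0 then [set x | - t i <= g i x] else set0.
  have rayB i : i \in J -> [set x | poisson_max (g i) x < - t i] = void N Y (B i).
    move=> iJ; rewrite poisson_max_lt; last by rewrite oppr_gt0 (allP t0).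
    by rewrite /B (allP t0).
  have mB i : measurable (B i).
    rewrite /B; case: ifP => // _.
    rewrite (_ : mkset _ = g i @^-1` `[- t i, +oo[).
      by rewrite -[X in measurable X]setTI; exact: mg.
    by apply/seteqP; split => x /=; rewrite in_itv /= andbT.
  rewrite (eq_big_seq (fun i => m (void N Y (B i)))); last first.
    by move=> i iJ; rewrite rayE rayB.
  rewrite -(leb01_bigcap_void H) //.
    by congr (m _); apply: eq_bigcapr => i iJ; rewrite rayE rayB.
  move=> i j ij; rewrite -(measure0 m); apply: ae_measure => //.
    exact: measurableI.
  apply: filterS (g0 i j ij) => x gx; split => // -[].
  rewrite /B; case: ifP => // ti; case: ifP => // tj /= hi hj.
  by case: gx => e; [move: hi|move: hj]; rewrite e oppr_le0 leNgt ?ti ?tj.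
(* Some event asks a nonnegative maximum to lie below [- t i <= 0]; it is empty and both sides
   vanish. *)
case/allPn=> i iJ; rewrite -leNgt => ti.
have r0 : (fun x => - poisson_max (g i) x) @^-1` `]t i, +oo[ = set0.
  rewrite rayE; apply/seteqP; split => x //=.
  by rewrite ltNge (le_trans _ (poisson_max_ge0 _ _)) // oppr_le0.
rewrite (_ : \bigcap_(_ in _) _ = set0).
  by rewrite measure0 (big_rem i) //= r0 measure0 mul0e.
by apply/seteqP; split => x // /(_ i iJ); rewrite r0.
Qed.

Section lower_bound.
Context (X : symmetric_space R).
Variables (b : R) (z0 : X).
Hypothesis z0E : {ae m, forall t, ss_fun z0 t = \1_(N @^-1` [set 0%N]) t}.
Hypothesis bE : `|z0| = b.
Hypothesis b0 : 0 < b.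

Let keep g n (t : T) : R := g (Y 0%N t) * \1_(N @^-1` [set n]) t.

Let measurable_keep (g : T -> R) n : measurable_fun setT g -> measurable_fun setT (keep g n).
Proof.
move=> mg; apply: measurable_funM; first exact: measurableT_comp.
by apply: measurable_indic; exact: (measurable_count H).
Qed.

Let keep_law (g : T -> R) : measurable_fun setT g -> (forall t, 0 <= g t) ->
  same_law m m (keep g 1) (keep g 0).
Proof.
move=> mg g0; apply: ray_unique; [exact: measurable_keep..|] => t.
have [t0|t0] := ltP t 0.
  suff h n : keep g n @^-1` `]t, +oo[ = setT by rewrite !h.
  apply/seteqP; split => x //= _; rewrite in_itv /= andbT.
  by rewrite (lt_le_trans t0) // mulr_ge0 // indicE.
have h n : m (keep g n @^-1` `]t, +oo[) =
    ((poisson_pmf 1 n)%:E * m (g @^-1` `]t, +oo[))%E.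
  have := poisson_joint H 1 [set n] (B := fun=> g @^-1` `]t, +oo[).
  rewrite big_ord1 (poisson_count H) => <-; last first.
    by move=> _; rewrite -[X in measurable X]setTI; exact: mg.
  congr (m _); apply/seteqP; split => x /=; rewrite !in_itv /= !andbT /keep indicE.
    case: (boolP (x \in _)) => [|_]; last by rewrite mulr0 ltNge t0.
    rewrite in_setE mulr1 => /= Nx tg; split => // -[|//] _ /=.
    by rewrite in_itv /= tg.
  case=> Nx /(_ 0%N erefl); rewrite /= in_itv /= andbT => tg.
  by rewrite mem_set // mulr1.
have p01 : poisson_pmf 1 1 = poisson_pmf 1 0 :> R.
  by rewrite /poisson_pmf ltr01 !expr1n.
by rewrite [LHS]h [RHS]h p01.
Qed.

(* Off [N = 0] the maximum dominates the value at the first point, and the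
   events [N = 0] and [N = 1] have the same probability. *)
Lemma poisson_max_lower (g : T -> R) (mu c : R) : measurable_fun setT g ->
  (forall t, 0 <= g t) -> 0 <= mu ->
  norm_le X (fun t => poisson_max g t - mu) c -> norm_le X g (2 * (c + c / b)).
Proof.
move=> mg g0 mu0 hc.
have c0 := norm_le_ge0 hc.
(* On [N = 0] the centred maximum is the constant [- mu], so it dominates in modulus [mu] times the
   indicator of that event, whose norm is [b]. *)
have mu_le : mu <= c / b.
  rewrite ler_pdivlMr // -bE -(ger0_norm mu0) -normrZ.
  pose h t := mu * \1_(N @^-1` [set 0%N]) t.
  apply: (@norm_leE _ _ _ h).
    by apply: filterS2 (ss_funZ mu z0) z0E => t -> ->.
  apply: norm_le_ideal hc.
    by apply: measurable_funM => //; apply: measurable_indic; exact: (measurable_count H).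
  apply: aeW => t; rewrite /h indicE.
  case: (boolP (t \in _)) => [|_]; last by rewrite mulr0 normr0.
  rewrite in_setE mulr1 /= => N0; rewrite /poisson_max N0 big_ord0 sub0r.
  by rewrite normrN.
have hM : norm_le X (poisson_max g) (c + c / b).
  apply: norm_le_eq (norm_leD hc (norm_le_trans _ (norm_le_cst X mu))).
    by apply: aeW => t; rewrite subrK.
  by rewrite ger0_norm.
have h1 : norm_le X (keep g 1) (c + c / b).
  apply: norm_le_ideal hM; first exact: measurable_keep.
  apply: aeW => t; rewrite !ger0_norm ?poisson_max_ge0 ?mulr_ge0 ?indicE //.
  rewrite /keep indicE; case: (boolP (t \in _)) => [|_].
    by rewrite in_setE mulr1 /= => N1; apply: poisson_max_ge; rewrite N1.
  by rewrite mulr0 poisson_max_ge0.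
have h0 : norm_le X (keep g 0) (c + c / b).
  by apply: norm_le_law h1; [exact: measurable_keep..|exact: keep_law].
have hY : norm_le X (g \o Y 0%N) (2 * (c + c / b)).
  have h2 := norm_leD hM h0; rewrite mulrDl mul1r.
  apply: norm_le_ideal h2; first exact: measurableT_comp.
  apply: aeW => t; rewrite !ger0_norm ?addr_ge0 ?poisson_max_ge0 ?mulr_ge0 ?indicE //=.
  rewrite /keep indicE; case: (boolP (t \in _)) => [_|].
    by rewrite mulr1 lerDr poisson_max_ge0.
  rewrite notin_setE mulr0 addr0 /= => N0; apply: poisson_max_ge.
  by rewrite lt0n; apply/eqP.
apply: norm_le_law hY => //; first exact: measurableT_comp.
move=> A mA; apply: (poisson_point_law H 0 (B := g @^-1` A)).
by rewrite -[X in measurable X]setTI; exact: mg.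
Qed.

End lower_bound.
End poisson_max.

(** * Kolmogorov widths and parabolas over finite fields *)

Section width.
Context (R : realType) (X : normedModType R).

(** [subspace_of_dim] asks for a basis, while the approximating averages come as a mere spanning
    family, possibly dependent. *)
Lemma independent_spanning n (v : 'I_n -> X) :
  exists m (b : 'I_m -> X), [/\ (m <= n)%N,
    forall c : 'I_m -> R, \sum_i c i *: b i = 0 -> forall i, c i = 0 &
    forall i, exists c : 'I_m -> R, v i = \sum_j c j *: b j].
Proof.
elim: n v => [|n IH] v.
  by exists 0%N, v; split => // [c _ []//|[]].
have [m [b [mn free span]]] := IH (fun i => v (widen_ord (leqnSn n) i)).
have [[c vc]|nspan] := pselect (exists c : 'I_m -> R, v ord_max = \sum_j c j *: b j).
  exists m, b; split => // [|i]; first exact: leqW.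
  have [->|ni] := eqVneq i ord_max; first by exists c.
  have i_n : (i < n)%N by rewrite ltn_neqAle -ltnS ltn_ord andbT.
  have [c' e] := span (Ordinal i_n); exists c'; rewrite -e; congr v; exact: val_inj.
pose b' (i : 'I_m.+1) := if unlift ord_max i is Some j then b j else v ord_max.
have sumE (c : 'I_m.+1 -> R) : \sum_i c i *: b' i =
    \sum_i c (widen_ord (leqnSn m) i) *: b i + c ord_max *: v ord_max.
  rewrite big_ord_recr /= /b' unlift_none; congr (_ + _).
  apply: eq_bigr => i _; rewrite (_ : widen_ord _ i = lift ord_max i) ?liftK //.
  by apply: val_inj; rewrite /= /bump leqNgt ltn_ord.
exists m.+1, b'; split => // [c|i].
  rewrite sumE => h; have [c0|c0] := eqVneq (c ord_max) 0; last first.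
    case: nspan; exists (fun j => - (c ord_max)^-1 * c (widen_ord (leqnSn m) j)).
    move/eqP: h; rewrite addrC addr_eq0 => /eqP/(congr1 (fun x => (c ord_max)^-1 *: x)).
    rewrite scalerA mulVf // scale1r => ->; rewrite scalerN scaler_sumr -sumrN.
    by apply: eq_bigr => j _; rewrite -scalerA scaleNr scalerA.
  rewrite c0 scale0r addr0 in h; move=> i.
  have [->//|ni] := eqVneq i ord_max.
  have i_m : (i < m)%N by rewrite ltn_neqAle -ltnS ltn_ord andbT.
  by rewrite -(free _ h (Ordinal i_m)); congr c; exact: val_inj.
have [->|ni] := eqVneq i ord_max.
  exists (fun j => (j == ord_max)%:R); rewrite sumE eqxx scale1r big1 ?add0r // => j _.
  by rewrite (_ : _ == _ = false) ?scale0r // -val_eqE /= ltn_eqF.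
have i_n : (i < n)%N by rewrite ltn_neqAle -ltnS ltn_ord andbT.
have [c e] := span (Ordinal i_n).
exists (fun j => if unlift ord_max j is Some k then c k else 0).
rewrite sumE unlift_none scale0r addr0.
rewrite (_ : i = widen_ord (leqnSn n) (Ordinal i_n)) ?e; last exact: val_inj.
apply: eq_bigr => j _; rewrite (_ : widen_ord _ j = lift ord_max j) ?liftK //.
by apply: val_inj; rewrite /= /bump leqNgt ltn_ord.
Qed.

Lemma kolmogorov_width_le (I : finType) (v : I -> X) (K : set X) n (e : R) :
  (#|I| <= n)%N ->
  (forall x, K x -> exists c : I -> R, `|x - \sum_i c i *: v i| <= e) ->
  (kolmogorov_width n K <= e%:E)%E.
Proof.
move=> In hK.
have [m [b [mI free span]]] := independent_spanning (fun i : 'I_#|I| => v (enum_val i)).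
have [d dE] := choice span.
pose V := [set \sum_i c i *: b i | c in [set: 'I_m -> R]].
apply: (@le_trans _ _
  (ereal_sup [set ereal_inf [set `|x - v|%:E | v in V] | x in K])).
  apply: ereal_inf_lbound; exists V => //; exists m; first exact: leq_trans In.
  by exists b.
apply: ge_ereal_sup => _ [x Kx <-].
have [c hc] := hK x Kx; apply: ge_ereal_inf.
exists `|x - \sum_i c i *: v i|%:E; last by rewrite lee_fin.
exists (\sum_i c i *: v i) => //.
exists (fun j => \sum_(i < #|I|) c (enum_val i) * d i j) => //.
rewrite [RHS](reindex (fun i : 'I_#|I| => enum_val i)) /=; last first.
  by exists enum_rank => i _; rewrite ?enum_valK ?enum_rankK.
under eq_bigr do rewrite scaler_suml.
rewrite exchange_big /=; apply: eq_bigr => i _; rewrite dE scaler_sumr.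
by apply: eq_bigr => j _; rewrite scalerA.
Qed.

End width.

Section parabolas.
Context (p : nat) (p_prime : prime p) (L : nat) (Lp : (L <= p)%N).

Definition parabola (k : 'I_L * 'F_p * 'F_p) (x : 'F_p) : 'F_p :=
  (k.1.1 : nat)%:R * x ^+ 2 + k.1.2 * x + k.2.

(** Points of agreement are roots of a difference of degree at most 2. It is a nonzero polynomial:
    [L <= p] keeps distinct leading coefficients below [L] distinct modulo [p]. *)
Lemma parabola_agree_le2 k j : k != j ->
  (#|[set x | parabola k x == parabola j x]%SET| <= 2)%N.
Proof.
move=> kj; set S := [set x | _]%SET.
pose Q : {poly 'F_p} := Poly [:: k.2 - j.2; k.1.2 - j.1.2;
  (k.1.1 : nat)%:R - (j.1.1 : nat)%:R].
have Q0 : Q != 0.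
  apply: contraNneq kj => Q0.
  have e i : ([:: k.2 - j.2; k.1.2 - j.1.2;
      (k.1.1 : nat)%:R - (j.1.1 : nat)%:R] : seq 'F_p)`_i = 0.
    by rewrite -coef_Poly -/Q Q0 coef0.
  have /eqP := e 0%N; rewrite subr_eq0 => /eqP e0.
  have /eqP := e 1%N; rewrite subr_eq0 => /eqP e1.
  have /eqP := e 2%N; rewrite subr_eq0 => /eqP e2.
  case: k j e0 e1 e2 {S Q Q0 e} => [[k1 k2] k3] [[j1 j2] j3] /= -> -> e2.
  suff -> : k1 = j1 by rewrite eqxx.
  apply: val_inj => /=; have := congr1 val e2; rewrite /= !val_Fp_nat //.
  by rewrite !modn_small // (leq_trans (ltn_ord _)).
have sQ : (size Q <= 3)%N by exact: size_Poly.
have rS : all (root Q) (enum S).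
  apply/allP => x; rewrite mem_enum inE => /eqP h.
  rewrite /root horner_Poly /= mul0r add0r; apply/eqP.
  move/eqP: h; rewrite -subr_eq0 => /eqP <-; rewrite /parabola expr2; ring.
rewrite cardE -ltnS; apply: leq_trans sQ.
exact: (max_poly_roots Q0 rS (enum_uniq _)).
Qed.

End parabolas.

(** * Estimates of l_q norms *)

Section lq.
Context (R : realType).

Lemma lq_norm_delta (q : \bar R) N (k : 'I_N) : (2%:E < q)%E ->
  1 <= lq_norm q (fun j => (j == k)%:R : R).
Proof.
case: q => [r| |] //= => [|_].
  rewrite lte_fin => r2; have r0 : 0 < r by exact: lt_trans r2.
  apply: (@le_trans _ _ (1 `^ r^-1)); first by rewrite powR1.
  apply: ge0_ler_powR.
  - by rewrite invr_ge0 ltW.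
  - by rewrite nnegrE.
  - by rewrite nnegrE; apply: sumr_ge0 => i _; exact: powR_ge0.
  rewrite (bigD1 k) //= eqxx normr1 powR1 /= lerDl.
  by apply: sumr_ge0 => i _; exact: powR_ge0.
apply: le_trans (le_bigmax _ _ k); by rewrite eqxx normr1.
Qed.

(* This is where [q > 2] enters: [L p^2 (2 / p)^r = 4 L (2 / p)^(r - 2)]. *)
Lemma lq_norm_small (q : \bar R) (L : nat) (e : R) : (2%:E < q)%E -> (0 < L)%N ->
  0 < e -> exists p0 : nat, forall p N (a : 'I_N -> R), (p0 <= p)%N -> (0 < p)%N ->
    (N <= L * (p * p))%N -> (forall k, `|a k| <= 2 / p%:R) -> lq_norm q a <= e.
Proof.
have large (t : R) (p : nat) : 0 < t -> (0 < p)%N ->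
    (Num.truncn (2 / t) < p)%N -> 2 / p%:R <= t.
  move=> t0 p0 tp; rewrite ler_pdivrMr ?ltr0n // mulrC -ler_pdivrMr //.
  by rewrite ltW // (lt_le_trans (truncnS_gt _)) // ler_nat.
case: q => [r| |] //= => [|_]; last first.
  move=> L0 e0; exists (Num.truncn (2 / e)).+1 => p N a pp p0 _ ha.
  apply/bigmax_leP; split => [|i _]; first exact: ltW.
  by rewrite (le_trans (ha i)) //; exact: large.
rewrite lte_fin => r2 L0 e0.
have r0 : 0 < r by exact: lt_trans r2.
have L0' : 0 < L%:R :> R by rewrite ltr0n.
(* The solution of [4 * L * t ^ (r - 2) = e ^ r]: once [2 / p <= t], the sum of the r-th powers is
   at most [e ^ r]. *)
pose t := (e `^ r / (4 * L%:R)) `^ (r - 2)^-1.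
have t0 : 0 < t by rewrite powR_gt0 // divr_gt0 ?powR_gt0 // mulr_gt0.
have tE : t `^ (r - 2) = e `^ r / (4 * L%:R).
  rewrite -powRrM mulVf ?powRr1 //; last by rewrite subr_eq0 gt_eqF.
  by rewrite divr_ge0 ?powR_ge0 // mulr_ge0.
exists (Num.truncn (2 / t)).+1 => p N a pp p0 Np ha.
have p0' : 0 < p%:R :> R by rewrite ltr0n.
have u0 : 0 < 2 / p%:R :> R by rewrite divr_gt0.
have hu : 2 / p%:R <= t by exact: large.
have -> : e = (e `^ r) `^ r^-1.
  by rewrite -powRrM mulfV ?powRr1 ?gt_eqF // ltW.
apply: ge0_ler_powR.
- by rewrite invr_ge0 ltW.
- by rewrite nnegrE; apply: sumr_ge0 => i _; exact: powR_ge0.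
- by rewrite nnegrE powR_ge0.
apply: (@le_trans _ _ (\sum_(k < N) (2 / p%:R) `^ r)).
  apply: ler_sum => k _; apply: ge0_ler_powR; rewrite ?nnegrE //; exact: ltW.
rewrite sumr_const card_ord -[_ *+ N]mulr_natl.
have -> : (2 / p%:R) `^ r = (2 / p%:R) `^ (r - 2) * (2 / p%:R) ^+ 2 :> R.
  rewrite -powR_mulrn ?(ltW u0) // -powRD; last by rewrite (gt_eqF u0) implybT.
  by rewrite subrK.
have h1 : (2 / p%:R) `^ (r - 2) <= e `^ r / (4 * L%:R) :> R.
  rewrite -tE; apply: ge0_ler_powR; rewrite ?nnegrE ?subr_ge0 ?(ltW r2) ?(ltW u0) ?(ltW t0) //.
apply: (@le_trans _ _ ((L * (p * p))%:R * ((e `^ r / (4 * L%:R)) * (2 / p%:R) ^+ 2))).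
  apply: ler_pM => //.
  - by rewrite ler_nat.
  - by rewrite ler_wpM2r // exprn_ge0 // ltW.
rewrite le_eqVlt; apply/orP; left; apply/eqP; rewrite !natrM.
by field; rewrite !gt_eqF.
Qed.

End lq.

(** * The main construction *)

Lemma normr_sum_disjoint (R : realDomainType) n (v : 'I_n -> R) :
  (forall i j, i != j -> v i = 0 \/ v j = 0) -> `|\sum_i v i| = \sum_i `|v i|.
Proof.
move=> h; have [[k vk]|nk] := pselect (exists k, v k != 0).
  rewrite (bigD1 k) //= [RHS](bigD1 k) //=.
  have z i : i != k -> v i = 0.
    by move=> /h[//|e]; rewrite e eqxx in vk.
  rewrite big1 => [|i /z //]; rewrite addr0 [X in _ + X]big1 ?addr0 // => i /z ->.
  exact: normr0.
have z i : v i = 0 by apply: contrapT => /eqP vi; apply: nk; exists i.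
rewrite big1 ?normr0 => [|i _ //]; rewrite big1 // => i _.
by rewrite z normr0.
Qed.

Section independent_maxima.
Context (R : realType) (X : symmetric_space R) (hK : kruglov_property X).
Local Notation T := (lebesgueTypeR R).
Local Notation m := (@leb01 R).

Lemma kruglov_op_norm_le N Y (H : @poisson_process R N Y) : exists2 C : R, 0 < C &
  forall (g : T -> R) c, measurable_fun setT g -> (forall t, 0 <= g t) -> 0 < c ->
  norm_le X g c -> norm_le X (kruglov_op N Y g) (C * c).
Proof.
have [C C0 hC] := kruglov_op_bounded H hK; exists C => // g c mg g0 c0 gc.
have h1 : norm_le X (fun t => c^-1 * g t) 1.
  by have := norm_leZ c^-1 gc; rewrite gtr0_norm ?invr_gt0 // mulVf // gt_eqF.
have h2 : norm_le X (kruglov_op N Y (fun t => c^-1 * g t)) C.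
  apply: hC h1; first exact: measurable_funM.
  by move=> t; rewrite mulr_ge0 // invr_ge0 ltW.
have := norm_leZ c h2; rewrite gtr0_norm // mulrC; apply: norm_le_eq.
apply: aeW => t; rewrite /kruglov_op -mulr_sumr mulrA mulfV ?mul1r //.
by rewrite gt_eqF.
Qed.

Lemma poisson_empty_norm N Y (H : @poisson_process R N Y) : exists2 z0 : X,
  {ae m, forall t, ss_fun z0 t = \1_(N @^-1` [set 0%N]) t} & 0 < `|z0|.
Proof.
have mI := measurable_count H 0%N.
have [z0 z0E _] : norm_le X (\1_(N @^-1` [set 0%N]) : T -> R) 1.
  apply: norm_le_ideal (norm_le1 X); first exact: measurable_indic.
  by apply: aeW => t; rewrite indicE normr1; case: (_ \in _); rewrite ?normr0 ?normr1.
exists z0 => //; rewrite normr_gt0; apply/eqP => z00.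
have : m (N @^-1` [set 0%N]) = 0%E.
  rewrite -(measure0 m); apply: ae_measure => //.
  rewrite z00 in z0E; apply: filterS2 z0E (ss_fun0 X) => t -> e.
  split => // Nt; move: e; rewrite indicE mem_set // => /eqP.
  by rewrite oner_eq0.
rewrite (poisson_count H) /poisson_pmf ltr01 => -[] /eqP.
by rewrite expr0 mul1r fact0 invr1 mul1r gt_eqF // expR_gt0.
Qed.

(** It matters that [D] is fixed before [n] and the [x k]: the number of functions is chosen in
    terms of [D] at the end. *)
Lemma independent_maxima (K : R) : 0 < K -> exists2 D : R, 0 < D &
  forall n (x : 'I_n -> X) (q : \bar R), (2%:E < q)%E ->
  (forall i j, i != j -> {ae m, forall t, ss_fun (x i) t = 0 \/ ss_fun (x j) t = 0}) ->
  (forall a : 'I_n -> R,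
    K^-1 * lq_norm q a <= `|\sum_k a k *: x k| <= K * lq_norm q a) ->
  exists f : 'I_n -> X,
    [/\ independent_functions m (fun k => ss_fun (f k)),
      forall k, (\int[m]_t (ss_fun (f k) t)%:E = 0)%E,
      forall k, 1 <= `|f k| &
      forall (a : 'I_n -> R) c, 0 < c -> lq_norm q a <= c ->
        `|\sum_k a k *: f k| <= D * c].
Proof.
move=> K0; have [N [Y [h1 h2 h3 h4]]] := poisson_points R.
have H : poisson_process N Y by split.
have [C C0 hC] := kruglov_op_norm_le H.
have [z0 z0E b0] := poisson_empty_norm H; set b := `|z0| in b0.
(* A centred maximum of norm [c] satisfies [K^-1 <= 2 * (c + c / b)], that is, [dl <= c]. Dividing
   by [dl] makes the norms at least 1. *)
pose dl := K^-1 / (2 * (1 + b^-1)).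
have dl0 : 0 < dl.
  by rewrite divr_gt0 ?invr_gt0 // mulr_gt0 // addr_gt0 // invr_gt0.
have dli0 : 0 < dl^-1 by rewrite invr_gt0.
(* [K] comes from the upper l_q-estimate of the [x k], [C] from the Kruglov operator, 2 from adding
   the mean, and [dl^-1] from the normalisation. *)
exists (dl^-1 * (2 * (C * K))); first by rewrite !mulr_gt0.
move=> n x q hq xdisj hx.
pose g k t : R := `|ss_fun (x k) t|.
have mx k : measurable_fun setT (ss_fun (x k)) by [].
have mg k : measurable_fun setT (g k) by exact: measurableT_comp.
have g0 k t : 0 <= g k t by exact: normr_ge0.
have gdisj i j : i != j -> {ae m, forall t, g i t = 0 \/ g j t = 0}.
  move=> /xdisj; apply: filterS => t [] e; [left|right];
  by rewrite /g e normr0.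
(* By disjointness this is the modulus of the combination of the [x k], and by linearity its image
   under the Kruglov operator dominates the combination of the maxima with weights [|a k|]. *)
pose S (a : 'I_n -> R) t := \sum_k `|a k| * g k t.
have mS a : measurable_fun setT (S a).
  by apply: measurable_sum => k; exact: measurable_funM.
have S0 a t : 0 <= S a t by apply: sumr_ge0 => k _; rewrite mulr_ge0.
have hS a : norm_le X (S a) (K * lq_norm q a).
  have /andP[_ hxa] := hx a.
  apply: norm_le_trans hxa _; apply: norm_le_ideal (norm_le_fun _) => //.
  have e1 := ss_fun_sum (index_enum 'I_n) a x.
  have e2 : {ae m, forall t, forall i j, i != j ->
      ss_fun (x i) t = 0 \/ ss_fun (x j) t = 0}.
    apply: ae_forall_ord => i; apply: ae_forall_ord => j.
    have [<-|ij] := eqVneq i j; first exact: aeW.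
    by apply: filterS (xdisj i j ij).
  apply: filterS2 e1 e2 => t -> e2.
  rewrite [leRHS]normr_sum_disjoint => [|i j /e2[e3|e3]]; last 2 first.
  - by left; rewrite /= e3 mulr0.
  - by right; rewrite /= e3 mulr0.
  rewrite ger0_norm //; apply: ler_sum => k _.
  by rewrite [leRHS]normrM.
pose M k := poisson_max N Y (g k).
have mM k : measurable_fun setT (M k) by exact: (measurable_poisson_max H).
have M0 k t : 0 <= M k t by exact: poisson_max_ge0.
have hMk k : exists c, norm_le X (M k) c.
  have gk : norm_le X (g k) (`|x k| + 1).
    apply: (@norm_le_trans _ _ _ `|x k|); first by rewrite lerDl.
    apply: norm_le_ideal (norm_le_fun (x k)) => //.
    by apply: aeW => t; rewrite normr_id.
  have c0 : 0 < `|x k| + 1 by rewrite ltr_wpDl.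
  exists (C * (`|x k| + 1)); apply: norm_le_ideal (hC _ _ (mg k) (g0 k) c0 gk) => //.
  apply: aeW => t; rewrite ger0_norm // (le_trans _ (ler_norm _)) //.
  exact: poisson_max_le.
pose mu k : R := fine (\int[m]_t (M k t)%:E)%E.
have muE k : (\int[m]_t (M k t)%:E)%E = (mu k)%:E.
  have [c Mc] := hMk k; rewrite fineK // ge0_fin_numE; last first.
    by apply: integral_ge0 => t _; rewrite lee_fin.
  by rewrite (le_lt_trans (mean_le_norm (mM k) (M0 k) Mc)) ?ltry.
have mu0 k : 0 <= mu k by rewrite fine_ge0 // integral_ge0 // => t _; rewrite lee_fin.
have hzM k : exists z : X, {ae m, forall t, ss_fun z t = M k t}.
  by have [c [z zM _]] := hMk k; exists z.
have [zM zME] := choice hzM.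
have [e eE _] := norm_le1 X.
pose f k : X := dl^-1 *: (zM k - mu k *: e).
pose F k t := dl^-1 * (M k t - mu k).
have hzf k : {ae m, forall t, ss_fun (zM k - mu k *: e) t = M k t - mu k}.
  have h : {ae m, forall t,
      ss_fun (zM k - mu k *: e) t = ss_fun (zM k) t - mu k * ss_fun e t}.
    by apply: filterS2 (ss_funB (zM k) (mu k *: e)) (ss_funZ (mu k) e) => t -> ->.
  by apply: filterS3 h (zME k) eE => t -> -> ->; rewrite mulr1.
have fF k : {ae m, forall t, ss_fun (f k) t = F k t}.
  by apply: filterS2 (ss_funZ dl^-1 (zM k - mu k *: e)) (hzf k) => t -> ->.
have mF k : measurable_fun setT (F k).
  by apply: measurable_funM => //; exact: measurable_funB.
exists f; split.
- apply: (independent_functions_ae (f := F)) => // [k|].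
    by apply: filterS (fF k) => t ->.
  apply: (independent_functions_comp (phi := fun k y => dl^-1 * (y - mu k))).
    by move=> k; apply: measurable_funM => //; exact: measurable_funB.
  exact: (poisson_max_independent H).
- move=> k.
  rewrite (ae_eq_integral (fun t => (F k t)%:E)) //; last 3 first.
  + exact/measurable_EFinP.
  + exact/measurable_EFinP.
  + by apply: filterS (fF k) => t -> _.
  have iM : m.-integrable setT (fun t => (M k t)%:E).
    apply/integrableP; split; first exact/measurable_EFinP.
    under eq_integral do rewrite gee0_abs ?lee_fin //.
    by rewrite muE ltry.
  have ic : m.-integrable setT (fun t => (mu k)%:E).
    by apply: finite_measure_integrable_cst.
  under eq_integral do rewrite EFinM EFinB.
  rewrite integralZl //; last exact: integrableB.
  rewrite integralB // muE.
  have -> : (\int[m]_t (mu k)%:E = (mu k)%:E)%E.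
    by rewrite integral_cst //= leb01_setT mule1.
  by rewrite subee // mule0.
- move=> k; rewrite normrZ gtr0_norm // mulrC ler_pdivlMr // mul1r.
  set c := `|_|.
  have hc : norm_le X (fun t => M k t - mu k) c.
    by exists (zM k - mu k *: e).
  have h := poisson_max_lower H z0E (erefl b) b0 (mg k) (g0 k) (mu0 k) hc.
  have xk : `|x k| <= 2 * (c + c / b).
    apply: (@norm_leE _ _ _ (ss_fun (x k))); first exact: aeW.
    by apply: norm_le_ideal h => //; apply: aeW => t; rewrite normr_id.
  have /andP[+ _] := hx (fun j => (j == k)%:R).
  rewrite (bigD1 k) //= eqxx scale1r big1 => [|j jk]; last first.
    by rewrite (negbTE jk) scale0r.
  rewrite addr0 => h5.
  have h6 : K^-1 <= 2 * (c + c / b).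
    apply: le_trans xk; apply: le_trans h5.
    by rewrite ler_peMr ?invr_ge0 ?(ltW K0) //; exact: lq_norm_delta.
  rewrite /dl ler_pdivrMr; last by rewrite mulr_gt0 // addr_gt0 // invr_gt0.
  by apply: (le_trans h6); rewrite le_eqVlt; apply/orP; left; apply/eqP; ring.
- move=> a c c0 ac.
  pose c' := C * (K * c).
  pose G t := \sum_k `|a k| * M k t.
  have mG : measurable_fun setT G.
    by apply: measurable_sum => k; exact: measurable_funM.
  have G0 t : 0 <= G t by apply: sumr_ge0 => k _; rewrite mulr_ge0.
  have hG : norm_le X G c'.
    have Kc0 : 0 < K * c by exact: mulr_gt0.
    have Sc : norm_le X (S a) (K * c).
      by apply: norm_le_trans (hS a); rewrite ler_pM2l.
    apply: norm_le_ideal (hC _ _ (mS a) (S0 a) Kc0 Sc) => //.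
    apply: aeW => t; rewrite ger0_norm // (le_trans _ (ler_norm _)) //.
    rewrite /kruglov_op exchange_big /=; apply: ler_sum => k _.
    by rewrite -mulr_sumr ler_wpM2l //; exact: poisson_max_le.
  (* Bounding the [mu k] one by one would produce an l_1 norm of [a]; the mean of the whole
     combination [G] keeps the l_q bound. *)
  have hmu : \sum_k `|a k| * mu k <= c'.
    rewrite -lee_fin; apply: le_trans (mean_le_norm mG G0 hG).
    rewrite le_eqVlt; apply/orP; left; apply/eqP.
    under [RHS]eq_integral do rewrite -sumEFin.
    rewrite ge0_integral_sum //; last 2 first.
    + by move=> k; apply/measurable_EFinP; exact: measurable_funM.
    + by move=> k t _; rewrite lee_fin mulr_ge0.
    rewrite -sumEFin; apply: eq_bigr => k _.
    under eq_integral do rewrite EFinM.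
    rewrite ge0_integralZl_EFin //; last exact/measurable_EFinP.
      by rewrite muE EFinM.
    by move=> t _; rewrite lee_fin.
  pose h t := dl^-1 * (\sum_k a k * M k t + - \sum_k a k * mu k).
  apply: (@norm_leE _ _ _ h).
    have e1 := ss_fun_sum (index_enum 'I_n) a f.
    apply: filterS2 e1 (ae_forall_ord fF) => t -> e2.
    rewrite /h -sumrB mulr_sumr; apply: eq_bigr => k _; rewrite e2 /F; ring.
  have haM : norm_le X (fun t => \sum_k a k * M k t) c'.
    apply: norm_le_ideal hG.
      by apply: measurable_sum => k; exact: measurable_funM.
    apply: aeW => t; rewrite (ger0_norm (G0 t)) (le_trans (ler_norm_sum _ _ _)) //.
    by apply: ler_sum => k _; rewrite normrM (ger0_norm (M0 k t)).
  have := norm_leZ dl^-1 (norm_leD haM (norm_le_cst X (- \sum_k a k * mu k))).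
  apply: norm_le_trans; rewrite gtr0_norm // -!mulrA ler_pM2l // normrN.
  apply: (@le_trans _ _ (c' + c')); last first.
    by rewrite le_eqVlt; apply/orP; left; apply/eqP; rewrite /c'; ring.
  apply: lerD => //; apply: le_trans hmu; rewrite (le_trans (ler_norm_sum _ _ _)) //.
  by apply: ler_sum => k _; rewrite normrM (ger0_norm (mu0 k)).
Qed.

End independent_maxima.

(* So the combinations on the right span at most [p ^ 2] dimensions, out of
   [L * p ^ 2] indices. *)
Lemma parabola_combination (R : realType) (V : lmodType R) (p L : nat)
    (f : 'I_L * 'F_p * 'F_p -> V) (k : 'I_L * 'F_p * 'F_p) : prime p ->
  \sum_(xy : 'F_p * 'F_p) (if xy.2 == parabola k xy.1 then p%:R^-1 else 0 : R) *:
    (\sum_(j | parabola j xy.1 == xy.2) f j) =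
  \sum_j (#|[set x | parabola k x == parabola j x]%SET|%:R / p%:R : R) *: f j.
Proof.
move=> p_prime.
rewrite -(pair_bigA _ (fun x y => (if y == parabola k x then p%:R^-1 else 0 : R) *:
    (\sum_(j | parabola j x == y) f j))) /=.
transitivity (\sum_x \sum_j ((parabola k x == parabola j x)%:R / p%:R : R) *: f j).
  apply: eq_bigr => x _; rewrite (bigD1 (parabola k x)) //= eqxx.
  rewrite [X in _ + X]big1 ?addr0 => [|y /negbTE ->]; last by rewrite scale0r.
  rewrite scaler_sumr big_mkcond; apply: eq_bigr => j _.
  by rewrite eq_sym; case: eqP => _; rewrite ?mul1r // mul0r scale0r.
rewrite exchange_big /=; apply: eq_bigr => j _.
rewrite -scaler_suml -mulr_suml -natr_sum; congr (_%:R / _ *: _).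
by rewrite -sum1dep_card [in RHS]big_mkcond; apply: eq_bigr => x _; case: eqP.
Qed.

Theorem theorem3 (R : realType) (X : symmetric_space R) (q : \bar R)
  (hK : kruglov_property X) (hq : (2%:E < q)%E)
  (hX : roughly_lattice_finitely_representable q X) : ~ property_IR X.
Proof.
case=> gam gam0 IR; have [K K0 {}hX] := hX.
have [D D0 hD] := independent_maxima hK K0.
(* Then [gam * L >= 1], so the [p ^ 2] averages fit into the allowed dimension [gam * L * p ^ 2]. *)
pose L := (Num.truncn gam^-1).+1.
have Lgam : 1 <= gam * L%:R.
  by rewrite mulrC -ler_pdivrMr // mul1r ltW // truncnS_gt.
(* An l_q norm at most [e] then gives an error at most [D * e = gam / 2], strictly below the width
   required by (IR). *)
pose e := gam / (2 * D).
have e0 : 0 < e by rewrite divr_gt0 // mulr_gt0.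
have [p0 hp0] := lq_norm_small hq (ltn0Sn _ : (0 < L)%N) e0.
have [p pmax p_prime] := prime_above (maxn p0 L).
have p_gt0 := prime_gt0 p_prime.
have pR : 0 < p%:R :> R by rewrite ltr0n.
have p0p : (p0 <= p)%N by rewrite ltnW // (leq_ltn_trans (leq_maxl _ _) pmax).
have Lp : (L <= p)%N by rewrite ltnW // (leq_ltn_trans (leq_maxr _ _) pmax).
pose J := ('I_L * 'F_p * 'F_p)%type.
pose n := #|{: J}|.
have nE : n = (L * (p * p))%N.
  by rewrite /n !card_prod card_ord card_Fp // mulnA.
have n_gt0 : (0 < n)%N by rewrite nE !muln_gt0 p_gt0.
have [x [xdisj hx]] := hX n n_gt0.
have [f [find fmean fge1 fle]] := hD n x q hq xdisj hx.
have := IR n n_gt0 f find fmean fge1; apply/negP; rewrite -ltNge.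
apply: (@le_lt_trans _ _ (gam / 2)%:E); last first.
  by rewrite lte_fin ltr_pdivrMr // mulr_natr mulr2n ltrDl.
pose F (j : J) : X := f (enum_rank j).
apply: (@kolmogorov_width_le _ _ _ (fun xy : 'F_p * 'F_p =>
    \sum_(j : J | parabola j xy.1 == xy.2) F j)).
  rewrite card_prod card_Fp // truncn_ge_nat ?mulr_ge0 ?(ltW gam0) // nE !natrM mulrA.
  by rewrite -[leLHS]mul1r ler_wpM2r // mulr_ge0.
move=> _ [k _ <-].
(* The generators are indexed by the points of the affine plane over F_p; those on the graph of the
   parabola [k] get weight [1 / p]. *)
exists (fun xy => if xy.2 == parabola (enum_val k) xy.1 then p%:R^-1 else 0).
rewrite parabola_combination //.
pose a (j : 'I_n) : R := (j == k)%:R -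
  #|[set x | parabola (enum_val k) x == parabola (enum_val j) x]%SET|%:R / p%:R.
have -> : f k - \sum_(j : J) (#|[set x | parabola (enum_val k) x == parabola j x]%SET|%:R
    / p%:R) *: F j = \sum_j a j *: f j.
  rewrite [X in _ - X](reindex (fun i : 'I_n => enum_val i)) /=; last first.
    by exists enum_rank => i _; rewrite ?enum_valK ?enum_rankK.
  rewrite /a; under [RHS]eq_bigr do rewrite scalerBl.
  rewrite sumrB; congr (_ - _); last first.
    by apply: eq_bigr => j _; rewrite /F enum_valK.
  rewrite (bigD1 k) //= eqxx scale1r big1 ?addr0 // => j /negbTE ->.
  by rewrite scale0r.
(* For [j = k] the parabola agrees with itself at all [p] points, so the coefficient is exactly
   [1 - 1 = 0]; the others have at most two points in common with it. *)
have ha j : `|a j| <= 2 / p%:R.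
  rewrite /a; have [->|jk] := eqVneq j k.
    rewrite (_ : [set x | _]%SET = [set: 'F_p]%SET) ?cardsT ?card_Fp ?divff ?subrr ?normr0 //.
    - by rewrite gt_eqF.
    - by apply/setP => y; rewrite !inE eqxx.
  rewrite sub0r normrN ger0_norm ?divr_ge0 // ler_pM2r ?invr_gt0 // ler_nat.
  apply: parabola_agree_le2 => //; rewrite (inj_eq enum_val_inj) eq_sym.
  exact: jk.
have ae := hp0 p n a p0p p_gt0 (eq_leq nE) ha.
apply: le_trans (fle a e e0 ae) _.
rewrite /e le_eqVlt; apply/orP; left; apply/eqP; field.
by rewrite gt_eqF.
Qed.
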